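(* If $M$ is an irreducible calibrated $\tilde H$-module with central character $t\in T$, then there is a unique skew local region $(t,J)$ (with this fixed $t$) such that, for all $w\in W$ with $R(w)\cap Z(t)=\emptyset$, $$\dim(M_{wt})=\begin{cases}1,&\text{if }w\in\mathcal F^{(t,J)},\\0,&\text{otherwise.}\end{cases}$$
   Context: Let $R$ be a reduced crystallographic root system spanning a real vector space $\mathfrak h_{\mathbb R}^*\cong\mathbb R^n$ with Weyl group $W$ and $W$-invariant inner product $\langle\,,\rangle$, positive roots $R^+$, negative roots $R^-=-R^+$, simple roots $\alpha_1,\dots,\alpha_n$, and simple reflections $s_1,\dots,s_n$. Let $\alpha_i^\vee=2\alpha_i/\langle\alpha_i,\alpha_i\rangle$, let $\omega_1,\dots,\omega_n$ be the fundamental weights, $\langle\omega_i,\alpha_j^\vee\rangle=\delta_{ij}$, and let $P=\sum_i\mathbb Z\omega_i$ be the weight lattice. Let $X=\{X^\lambda\mid\lambda\in P\}$ be the group with $X^\lambda X^\mu=X^{\lambda+\mu}$, with $W$-action $wX^\lambda=X^{w\lambda}$, and let $\mathbb C[X]$ be its group algebra. Fix $q\in\mathbb C^*$ with $q^2\ne\pm1$. The affine Hecke algebra $\tilde H$ is the $\mathbb C$-algebra generated by $T_1,\dots,T_n$ and $X^\lambda$ ($\lambda\in P$), with relations: $T_i^2=(q-q^{-1})T_i+1$; the braid relations $T_iT_jT_i\cdots=T_jT_iT_j\cdots$ ($m_{ij}$ factors on each side, $m_{ij}$ the order of $s_is_j$ in $W$) for $i\neq j$; $X^\lambda X^\mu=X^{\lambda+\mu}$;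 and $$X^\lambda T_i=T_iX^{s_i\lambda}+(q-q^{-1})\frac{X^\lambda-X^{s_i\lambda}}{1-X^{-\alpha_i}}.$$ The center of $\tilde H$ is $\mathbb C[X]^W$, and all irreducible $\tilde H$-modules are finite dimensional. Let $T=\mathrm{Hom}(X,\mathbb C^* )$ be the set of group homomorphisms $X\to\mathbb C^*$ (extended linearly to $\mathbb C[X]$), with $W$-action $(wt)(X^\lambda)=t(X^{w^{-1}\lambda})$. A central character of an irreducible module $M$ is an element $t\in T$ such that $pm=t(p)m$ for all $m\in M$, $p\in\mathbb C[X]^W$; it is determined only up to the $W$-action. For a finite dimensional module $M$ over $\tilde H$ (or over a subalgebra containing $\mathbb C[X]$) and $t\in T$, $$M_t=\{m\in M\mid X^\lambda m=t(X^\lambda)m\ \forall X^\lambda\in X\},$$ $$M_t^{\rm gen}=\{m\in M\mid\text{for each }X^\lambda\in X,\ (X^\lambda-t(X^\lambda))^km=0\text{ for some }k\in\mathbb Z_{>0}\}.$$ $t$ is a weight of $M$ if $M_t\neq0$, and $M$ is calibrated if $M_t^{\rm gen}=M_t$ for all $t\in T$. For $w\in W$ let $R(w)=\{\alpha\in R^+\mid w\alpha\in R^-\}$. For $t\in T$, $$Z(t)=\{\alpha\in R^+\mid t(X^\alpha)=1\},\qquad P(t)=\{\alpha\in R^+\mid t(X^\alpha)=q^{2}\text{ or }q^{-2}\},$$ and for $J\subseteq P(t)$, $\mathcal F^{(t,J)}=\{w\in W\mid R(w)\cap Z(t)=\emptyset,\ R(w)\cap P(t)=J\}$. A local region is a pair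 $(t,J)$ with $t\in T$, $J\subseteq P(t)$ and $\mathcal F^{(t,J)}\ne\emptyset$. An element $t\in T$ is calibratable if for all $i,j\in\{1,\dots,n\}$ (with $i=j$ allowed), $t$ is a weight of some finite dimensional calibrated module for the subalgebra of $\tilde H$ generated by $T_i$, $T_j$ and $\mathbb C[X]$. A local region $(t,J)$ is skew if $wt$ is calibratable for all $w\in\mathcal F^{(t,J)}$. *)

(* Defs.v *)
From HB Require Import structures.
From mathcomp Require Import all_boot all_order all_algebra.
From mathcomp Require Import generic_quotient complex finmap monalg.
From mathcomp Require Import ring.
From mathcomp Require Import boolp classical_sets reals.

Set Implicit Arguments.
Unset Strict Implicit.
Unset Printing Implicit Defensive.

Import Order.TTheory GRing.Theory Num.Theory.

Local Open Scope classical_set_scope.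
Local Open Scope quotient_scope.
Local Open Scope ring_scope.

Definition coroot (R : realType) (V : lmodType R) (ip : V -> V -> R) (a : V) : V :=
  (2 / ip a a) *: a.

Definition reflection (R : realType) (V : lmodType R) (ip : V -> V -> R)
    (a v : V) : V :=
  v - ip v (coroot ip a) *: a.

(* A reduced crystallographic root system of rank n spanning V, with a base
   and the fundamental weights attached to it.  The reflections are orthogonal
   for ip, so ip is automatically invariant under the Weyl group. *)
Record rootSystem (R : realType) (V : vectType R) (n : nat) := RootSystem {
  ip : V -> V -> R;
  ip_linear : forall v a u w, ip (a *: u + w) v = a * ip u v + ip w v;
  ip_sym : forall u v, ip u v = ip v u;
  ip_pos : forall v, v != 0 -> 0 < ip v v;
  roots : seq V;
  roots_neq0 : 0 \notin roots;
  roots_span : <<roots>>%VS = fullv;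
  roots_reflection : forall a b,
    a \in roots -> b \in roots -> reflection ip a b \in roots;
  roots_int : forall a b,
    a \in roots -> b \in roots -> ip b (coroot ip a) \is a Num.int;
  roots_reduced : forall a (c : R),
    a \in roots -> c *: a \in roots -> c = 1 \/ c = -1;
  simple : 'I_n -> V;
  simple_roots : forall i, simple i \in roots;
  simple_basis : basis_of fullv [tuple simple i | i < n];
  simple_sign : forall a, a \in roots -> exists c : 'I_n -> nat,
    a = \sum_i (c i)%:R *: simple i \/ a = - \sum_i (c i)%:R *: simple i;
  fweight : 'I_n -> V;
  fweightE : forall i j, ip (fweight i) (coroot ip (simple j)) = (i == j)%:R
}.

Section RootSystem.
Variables (R : realType) (V : vectType R) (n : nat) (rs : rootSystem V n).

Definition positive_root (a : V) : Prop :=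
  a \in roots rs /\ exists c : 'I_n -> nat, a = \sum_i (c i)%:R *: simple rs i.

Definition negative_root (a : V) : Prop := positive_root (- a).

Lemma ip_lin v : linear (ip rs ^~ v : V -> R^o).
Proof. by move=> a u w; rewrite ip_linear. Qed.

Lemma ipDl u w v : ip rs (u + w) v = ip rs u v + ip rs w v.
Proof. by rewrite -[u in LHS]scale1r ip_linear mul1r. Qed.

Lemma ip0l v : ip rs 0 v = 0.
Proof. by apply: (addrI (ip rs 0 v)); rewrite -ipDl !addr0. Qed.

Lemma ipZl a u v : ip rs (a *: u) v = a * ip rs u v.
Proof. by rewrite -[a *: u]addr0 ip_linear ip0l addr0. Qed.

Lemma ipNl u v : ip rs (- u) v = - ip rs u v.
Proof. by rewrite -scaleN1r ipZl mulN1r. Qed.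

Lemma ipBl u w v : ip rs (u - w) v = ip rs u v - ip rs w v.
Proof. by rewrite ipDl ipNl. Qed.

Lemma ipDr u w v : ip rs v (u + w) = ip rs v u + ip rs v w.
Proof. by rewrite ip_sym ipDl !(ip_sym _ v). Qed.

Lemma ipZr a u v : ip rs v (a *: u) = a * ip rs v u.
Proof. by rewrite ip_sym ipZl ip_sym. Qed.

Lemma ipNr u v : ip rs v (- u) = - ip rs v u.
Proof. by rewrite ip_sym ipNl ip_sym. Qed.

Lemma ipBr u w v : ip rs v (u - w) = ip rs v u - ip rs v w.
Proof. by rewrite ipDr ipNr. Qed.

Lemma ip_suml I (r : seq I) P (F : I -> V) v :
  ip rs (\sum_(i <- r | P i) F i) v = \sum_(i <- r | P i) ip rs (F i) v.
Proof.
by apply: (big_morph (fun u => ip rs u v)) => [u w|]; [exact: ipDl|exact: ip0l].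
Qed.

Definition refl (a : V) : V -> V := reflection (ip rs) a.

Fact refl_linear a : linear (refl a).
Proof.
move=> c u v; rewrite /refl /reflection ip_linear scalerDl scalerBr !scalerA.
by rewrite opprD addrACA.
Qed.

HB.instance Definition _ a := GRing.isLinear.Build R V V _ (refl a) (refl_linear a).

Definition s_ (a : V) : 'End(V) := linfun (refl a).

(* s_ a is an involution, so this submonoid generated by reflections is a
   group. *)
Inductive weyl : 'End(V) -> Prop :=
| weyl1 : weyl \1%VF
| weylM a w : a \in roots rs -> weyl w -> weyl (s_ a \o w)%VF.

Definition has_order (w : 'End(V)) (m : nat) : Prop :=
  [/\ (0 < m)%N, (forall v, iter m w v = v)
    & forall k, (0 < k < m)%N -> ~ (forall v, iter k w v = v)].

Definition weight_lattice : {pred V} := fun v =>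
  `[< exists z : 'I_n -> int, v = \sum_i (z i)%:~R *: fweight rs i >].

Fact weight_lattice_zmod : zmod_closed weight_lattice.
Proof.
split=> [|u v /asboolP[z ->] /asboolP[y ->]]; apply/asboolP.
  by exists (fun=> 0); rewrite big1 // => i _; rewrite scale0r.
exists (fun i => z i - y i); rewrite -sumrB; apply: eq_bigr => i _.
by rewrite rmorphB scalerBl.
Qed.

HB.instance Definition _ :=
  GRing.isZmodClosed.Build V weight_lattice weight_lattice_zmod.

Record weight := Weight { wval : V; _ : wval \in weight_lattice }.

HB.instance Definition _ := [isSub for wval].
HB.instance Definition _ := [Choice of weight by <:].
HB.instance Definition _ := [SubChoice_isSubZmodule of weight by <:].


Lemma ip_coroot v a : ip rs v (coroot (ip rs) a) = 2 / ip rs a a * ip rs v a.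
Proof. by rewrite /coroot ipZr. Qed.

Lemma root_neq0 a : a \in roots rs -> a != 0.
Proof. by apply: contraL => /eqP->; exact: roots_neq0. Qed.

Lemma ip_root_gt0 a : a \in roots rs -> 0 < ip rs a a.
Proof. by move/root_neq0; exact: ip_pos. Qed.

Lemma ip_simple_eq0 v :
  (forall j, ip rs v (coroot (ip rs) (simple rs j)) = 0) -> v = 0.
Proof.
move=> v0; have {}v0 j : ip rs v (simple rs j) = 0.
  have := v0 j; rewrite ip_coroot => /eqP; rewrite mulf_eq0 => /orP[|/eqP//].
  by rewrite mulf_eq0 invr_eq0 pnatr_eq0 /= gt_eqF // ip_root_gt0 ?simple_roots.
apply/eqP/negPn/negP => /(ip_pos rs)/gt_eqF/negP; apply.
have : v \in <<[tuple simple rs i | i < n]>>%VS.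
  by rewrite (span_basis (simple_basis rs)) memvf.
move/coord_span => {2}->; apply/eqP; rewrite ip_sym ip_suml big1 // => i _.
by rewrite (nth_map i) ?size_enum_ord // nth_ord_enum ipZl ip_sym v0 mulr0.
Qed.

Lemma fweight_coord v :
  v = \sum_i ip rs v (coroot (ip rs) (simple rs i)) *: fweight rs i.
Proof.
apply/eqP; rewrite -subr_eq0; apply/eqP; apply: ip_simple_eq0 => j.
rewrite ipBl ip_suml (bigD1 j) //= ipZl fweightE eqxx mulr1 big1 ?addr0 ?subrr//.
by move=> i /negPf ij; rewrite ipZl fweightE ij mulr0.
Qed.

Lemma weight_latticeP v :
  (v \in weight_lattice) <->
  (forall i, ip rs v (coroot (ip rs) (simple rs i)) \is a Num.int).
Proof.
split=> [/asboolP[z ->] j|vint].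
  rewrite ip_suml (bigD1 j) //= ipZl fweightE eqxx mulr1 big1 ?addr0 ?intr_int//.
  by move=> i /negPf ij; rewrite ipZl fweightE ij mulr0.
apply/asboolP.
exists (fun i => Num.floor (ip rs v (coroot (ip rs) (simple rs i)))).
rewrite [LHS]fweight_coord; apply: eq_bigr => i _; congr (_ *: _).
by apply/esym/floorK.
Qed.

Lemma root_weight a : a \in roots rs -> a \in weight_lattice.
Proof. by move=> ar; apply/weight_latticeP => i; rewrite roots_int ?simple_roots. Qed.

Lemma ip_refl a u v : a \in roots rs -> ip rs (refl a u) (refl a v) = ip rs u v.
Proof.
move=> /ip_root_gt0 a0; rewrite /refl /reflection !ip_coroot !(ipBl, ipBr, ipZl, ipZr).
rewrite (ip_sym _ a v); set x := ip rs a a; have x0 : x != 0 by rewrite gt_eqF.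
by field.
Qed.

Lemma reflK a : a \in roots rs -> involutive (refl a).
Proof.
move=> /ip_root_gt0 a0 v; rewrite /refl /reflection !ip_coroot ipBl ipZl.
rewrite -addrA -opprD -scalerDl; set c := (X in X *: a).
rewrite (_ : c = 0) ?scale0r ?subr0// /c.
have x0 : ip rs a a != 0 by rewrite gt_eqF.
by field.
Qed.

Lemma ip_coroot_refl a b v : a \in roots rs ->
  ip rs (refl a v) (coroot (ip rs) (refl a b)) = ip rs v (coroot (ip rs) b).
Proof. by move=> ar; rewrite !ip_coroot !ip_refl. Qed.

Lemma refl_simple_weight i v :
  v \in weight_lattice -> refl (simple rs i) v \in weight_lattice.
Proof.
move=> vP; rewrite /refl /reflection; set c := ip _ _ _.
have : c \is a Num.int by rewrite /c; move/weight_latticeP: vP; apply.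
move=> /intrP[z ->]; rewrite scaler_int rpredB // rpredMz // root_weight //.
exact: simple_roots.
Qed.

Lemma simple_free (c d : 'I_n -> R) :
  \sum_i c i *: simple rs i = \sum_i d i *: simple rs i -> forall i, c i = d i.
Proof.
move=> cd i; have /freeP/(_ (fun i => c i - d i)) := basis_free (simple_basis rs).
have E e : \sum_(i < n) e i *: [tuple simple rs i | i < n]`_i
           = \sum_i e i *: simple rs i.
  by apply: eq_bigr => j _; rewrite (nth_map j) ?size_enum_ord // nth_ord_enum.
rewrite E; under eq_bigr do rewrite scalerBl.
by rewrite sumrB cd subrr => /(_ erefl i)/eqP; rewrite subr_eq0 => /eqP.
Qed.

Lemma ip_weight_coroot_pos a : positive_root a ->
  forall v, v \in weight_lattice -> ip rs v (coroot (ip rs) a) \is a Num.int.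
Proof.
move=> [+ [c]]; have [h] := ubnP (\sum_i c i)%N.
elim: h => // h IH in a c *; rewrite ltnS => ch ar aE v vP.
have [[i cai]|/forallNP nai] :=
    pselect (exists i, 0 < (c i)%:R * ip rs a (simple rs i)); last first.
  have := ip_root_gt0 ar; rewrite ltNge => /negP[].
  rewrite {2}aE ip_sym ip_suml sumr_le0 // => i _.
  by rewrite ipZl ip_sym leNgt; apply/negP/nai.
have ci0 : (0 < c i)%N.
  by rewrite lt0n; apply: contraTneq cai => ->; rewrite mul0r ltxx.
have ai0 : 0 < ip rs a (simple rs i) by rewrite pmulr_rgt0 // ltr0n in cai.
have si := simple_roots rs i.
set b := refl (simple rs i) a.
have br : b \in roots rs by exact: roots_reflection.
set k := ip rs a (coroot (ip rs) (simple rs i)).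
have k0 : 0 < k.
  by rewrite /k ip_coroot !mulr_gt0 // ?invr_gt0 ?ip_root_gt0.
have bE : b = \sum_j ((c j)%:R - k * (j == i)%:R) *: simple rs j.
  under eq_bigr do rewrite scalerBl.
  rewrite sumrB -aE /b /refl /reflection; congr (_ - _).
  rewrite (bigD1 i) //= eqxx mulr1 big1 ?addr0// => j /negPf->.
  by rewrite mulr0 scale0r.
have [d [dE|dE]] := simple_sign br.
  have dj := simple_free (etrans (esym bE) dE).
  rewrite -(ip_coroot_refl a v si); apply: (IH _ d) => //; last first.
    exact: refl_simple_weight.
  apply: leq_trans ch; rewrite (bigD1 i) //= [ltnRHS](bigD1 i) //= -addSn leq_add//.
    by rewrite -(ltr_nat R) -dj eqxx mulr1 ltrBlDr ltrDl.
  by rewrite leq_sum // => j /negPf ji; rewrite -(ler_nat R) -dj ji mulr0 subr0.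
(* otherwise a is a multiple of simple i *)
have dj j : (c j)%:R - k * (j == i)%:R = - (d j)%:R :> R.
  apply: (simple_free (c := fun j => (c j)%:R - k * (j == i)%:R)
            (d := fun j => - (d j)%:R)).
  by rewrite -bE dE -sumrN; apply: eq_bigr => j' _; rewrite scaleNr.
have aS : a = (c i)%:R *: simple rs i.
  rewrite {1}aE (bigD1 i) //= big1 ?addr0// => j /negPf ji.
  have := dj j; rewrite ji mulr0 subr0 => cd.
  suff -> : (c j)%:R = 0 :> R by rewrite scale0r.
  by apply/eqP; rewrite eq_le ler0n andbT cd oppr_le0 ler0n.
have [|c1|c1] := @roots_reduced _ _ _ rs (simple rs i) (c i)%:R si.
- by rewrite -aS.
- by rewrite aS c1 scale1r; move/weight_latticeP: vP; apply.
- by have := ler0n R (c i); rewrite c1 oppr_ge0 ler10.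
Qed.

Lemma coroot_opp a : coroot (ip rs) (- a) = - coroot (ip rs) a.
Proof. by rewrite /coroot ipNl ipNr opprK scalerN. Qed.

Lemma refl_weight a v : a \in roots rs ->
  v \in weight_lattice -> refl a v \in weight_lattice.
Proof.
move=> ar vP; rewrite /refl /reflection; set c := ip _ _ _.
suff : c \is a Num.int.
  by move=> /intrP[z ->]; rewrite scaler_int rpredB // rpredMz // root_weight.
have [d [dE|dE]] := simple_sign ar.
  by apply: ip_weight_coroot_pos => //; split=> //; exists d.
rewrite /c -[a]opprK coroot_opp ipNr rpredN.
apply: ip_weight_coroot_pos => //; split; last by exists d; rewrite dE opprK.
have := roots_reflection ar ar; rewrite /reflection ip_coroot.
have x0 : ip rs a a != 0 by rewrite gt_eqF // ip_root_gt0.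
by rewrite divfK // mulr2n scalerDl scale1r opprD addrA subrr sub0r.
Qed.

Lemma weyl_weight w v : weyl w ->
  v \in weight_lattice -> w v \in weight_lattice.
Proof.
move=> ww; elim: ww v => [v|a {}w ar _ IH v] vP; first by rewrite id_lfunE.
by rewrite comp_lfunE lfunE /= refl_weight // IH.
Qed.

(* The default value 0 is never used when w is in the Weyl group, see
   val_wact. *)
Definition wact (w : 'End(V)) (l : weight) : weight := insubd 0 (w (wval l)).

Lemma val_wact w l : weyl w -> wval (wact w l) = w (wval l).
Proof. by move=> ww; rewrite /wact insubdK // weyl_weight //; exact: valP. Qed.

Lemma weyl_s a : a \in roots rs -> weyl (s_ a).
Proof. by move=> ar; rewrite -[s_ a]comp_lfun1r; apply: weylM => //; exact: weyl1. Qed.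

Definition simple_weight (i : 'I_n) : weight :=
  Weight (root_weight (simple_roots rs i)).

End RootSystem.

Section Torus.
Variables (R : realType) (V : vectType R) (n : nat) (rs : rootSystem V n).
Variable q : R[i].

(* t l stands for t(X^l). *)
Definition torus (t : weight rs -> R[i]) : Prop :=
  (forall l, t l != 0) /\ {morph t : l m / l + m >-> l * m}.

Definition tact (w : 'End(V)) (t : weight rs -> R[i]) : weight rs -> R[i] :=
  fun l => t (wact (w^-1)%VF l).

(* Roots are weights (root_weight), so sets of roots are sets of weights. *)
Definition inversions (w : 'End(V)) : set (weight rs) :=
  [set a | positive_root rs (wval a) /\ negative_root rs (w (wval a))].

Definition Zset (t : weight rs -> R[i]) : set (weight rs) :=
  [set a | positive_root rs (wval a) /\ t a = 1].

Definition Pset (t : weight rs -> R[i]) : set (weight rs) :=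
  [set a | positive_root rs (wval a) /\ (t a = q ^+ 2 \/ t a = q ^- 2)].

Definition Fset (t : weight rs -> R[i]) (J : set (weight rs)) : set 'End(V) :=
  [set w | [/\ weyl rs w, inversions w `&` Zset t = set0
             & inversions w `&` Pset t = J]].

Definition local_region (t : weight rs -> R[i]) (J : set (weight rs)) : Prop :=
  [/\ torus t, J `<=` Pset t & Fset t J !=set0].

Definition group_algebra := {malg (R[i]) [weight rs]}.

Definition invariant (p : group_algebra) : Prop :=
  forall w l, weyl rs w -> p@_(wact w l) = p@_l.

Definition mulX (m : weight rs) (p : group_algebra) : group_algebra :=
  \sum_(l <- msupp p) << p@_l *g l + m >>.

(* f is the element (X^l - X^{s_i l}) / (1 - X^{-alpha_i}) of C[X]; see
   demazure_exists and demazure_unique. *)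
Definition demazure (i : 'I_n) (l : weight rs) (f : group_algebra) : Prop :=
  f - mulX (- simple_weight rs i) f =
    << l >> - << wact (s_ rs (simple rs i)) l >>.

Lemma mcoeff_mulX m p l : (mulX m p)@_l = p@_(l - m).
Proof.
rewrite /mulX raddf_sum /=.
under eq_bigr do rewrite mcoeffU eq_sym -subr_eq eq_sym.
have [lp|lp] := boolP (l - m \in msupp p); last first.
  rewrite (mcoeff_outdom lp) big_seq big1 // => k kp.
  by case: eqP => // kl; rewrite -kl kp in lp.
rewrite (bigD1_seq (l - m)) ?fset_uniq //= eqxx big1 ?addr0 //.
by move=> k /negPf ->.
Qed.

Lemma wact_simple i l : exists z : int,
  wact (s_ rs (simple rs i)) l = l - simple_weight rs i *~ z.
Proof.
have si := simple_roots rs i.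
have /weight_latticeP/(_ i)/intrP[z zE] := valP l.
exists z; apply: val_inj; rewrite raddfB raddfMz /=.
have -> := val_wact l (weyl_s si).
by rewrite lfunE /= /refl /reflection zE scaler_int.
Qed.

Lemma mulXD m p1 p2 : mulX m (p1 + p2) = mulX m p1 + mulX m p2.
Proof. by apply/malgP => l; rewrite !(mcoeff_mulX, mcoeffD). Qed.

Lemma mulXN m p : mulX m (- p) = - mulX m p.
Proof. by apply/malgP => l; rewrite !(mcoeff_mulX, mcoeffN). Qed.

Lemma mulXU m l : mulX m << l >> = << l + m >>.
Proof.
apply/malgP => k; rewrite mcoeff_mulX !mcoeffU.
by rewrite -[in LHS](inj_eq (addIr m)) subrK.
Qed.

Lemma demazure_exists i l : exists f, demazure i l f.
Proof.
have geom k (l' : weight rs) : exists f : group_algebra,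
    f - mulX (- simple_weight rs i) f = << l' >> - << l' - simple_weight rs i *+ k >>.
  elim: k => [|k [f fE]].
    exists 0; apply/malgP => m.
    by rewrite mulr0n subr0 subrr mcoeffB mcoeff_mulX !mcoeff0 subrr.
  exists (f + << l' - simple_weight rs i *+ k >>).
  rewrite mulXD mulXU opprD addrACA fE.
  by rewrite addrA subrK mulrSr opprD addrA.
rewrite /demazure; have [[k|k] ->] := wact_simple i l; first exact: geom.
set l' : weight rs := l - _; have [f fE] := geom k.+1 l'.
exists (- f); rewrite mulXN -opprD fE opprB; congr (<< _ >> - _).
by rewrite /l' NegzE mulrNz opprK addrK.
Qed.

Lemma demazure_unique i l f g : demazure i l f -> demazure i l g -> f = g.
Proof.
move=> fl gl; pose a := simple_weight rs i.
have hm m : (f - g)@_m = (f - g)@_(m + a).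
  have : f - g - mulX (- a) (f - g) = 0.
    by rewrite mulXD mulXN opprD addrACA -opprD fl gl subrr.
  move=> /(congr1 (mcoeff m))/eqP.
  by rewrite mcoeffB mcoeff_mulX opprK mcoeff0 subr_eq0 => /eqP.
apply/eqP; rewrite -subr_eq0; apply/eqP/malgP => m; rewrite mcoeff0.
apply/eqP/negPn/negP => fgm.
have fgk k : m + a *+ k \in msupp (f - g).
  rewrite -mcoeff_neq0; elim: k => [|k IH]; first by rewrite addr0.
  by rewrite mulrSr addrA -hm.
have a_inj : injective (fun k => m + a *+ k).
  move=> j k /addrI/(congr1 (@wval _ _ _ _))/eqP.
  rewrite -[X in X == _]/(val _) -[X in _ == X]/(val _) !raddfMn /= -!scaler_nat.
  rewrite -subr_eq0 -scalerBl scaler_eq0 subr_eq0 eqr_nat => /orP[/eqP//|].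
  by rewrite (negPf (root_neq0 (simple_roots rs i))).
pose s := [seq m + a *+ k | k <- iota 0 (size (msupp (f - g))).+1].
have us : uniq s by rewrite map_inj_uniq // iota_uniq.
have ss : {subset s <= enum_fset (msupp (f - g))} by move=> _ /mapP[k _ ->].
by have := uniq_leq_size us ss; rewrite size_map size_iota ltnn.
Qed.

End Torus.

Section Hecke.
Variables (R : realType) (V : vectType R) (n : nat) (rs : rootSystem V n).
Variable q : R[i].

(* Noncommutative polynomial expressions in the generators T_i and X^l. *)
Inductive hterm : Type :=
| HC of R[i]
| HT of 'I_n
| HX of weight rs
| HAdd of hterm & hterm
| HMul of hterm & hterm.

Declare Scope hterm_scope.
Bind Scope hterm_scope with hterm.
Local Delimit Scope hterm_scope with H.
Local Notation "x + y" := (HAdd x y) : hterm_scope.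
Local Notation "x * y" := (HMul x y) : hterm_scope.

Definition HP (p : group_algebra rs) : hterm :=
  \big[HAdd/HC 0]_(l <- msupp p) (HC p@_l * HX l)%H.

(* T_i T_j T_i ... with m factors *)
Definition HBraid (i j : 'I_n) (m : nat) : hterm :=
  \big[HMul/HC 1]_(k < m) HT (if odd k then j else i).

(* The smallest congruence satisfying the axioms of C-algebras and the defining
   relations of the affine Hecke algebra. *)
Inductive heq : hterm -> hterm -> Prop :=
| heq_refl x : heq x x
| heq_sym x y : heq x y -> heq y x
| heq_trans x y z : heq x y -> heq y z -> heq x z
| heq_add x x' y y' : heq x x' -> heq y y' -> heq (x + y) (x' + y')
| heq_mul x x' y y' : heq x x' -> heq y y' -> heq (x * y) (x' * y')
| heq_addA x y z : heq (x + (y + z)) (x + y + z)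
| heq_addC x y : heq (x + y) (y + x)
| heq_add0 x : heq (HC 0 + x) x
| heq_addN x : heq (HC (-1) * x + x) (HC 0)
| heq_mulA x y z : heq (x * (y * z)) (x * y * z)
| heq_mul1l x : heq (HC 1 * x) x
| heq_mul1r x : heq (x * HC 1) x
| heq_mulDl x y z : heq ((x + y) * z) (x * z + y * z)
| heq_mulDr x y z : heq (x * (y + z)) (x * y + x * z)
| heq_constD a b : heq (HC (a + b)) (HC a + HC b)
| heq_constM a b : heq (HC (a * b)) (HC a * HC b)
| heq_constC a x : heq (HC a * x) (x * HC a)
| heq_quadratic i : heq (HT i * HT i) (HC (q - q^-1) * HT i + HC 1)
| heq_braid i j m : i != j ->
    has_order (s_ rs (simple rs i) \o s_ rs (simple rs j))%VF m ->
    heq (HBraid i j m) (HBraid j i m)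
| heq_X0 : heq (HX 0) (HC 1)
| heq_XD l m : heq (HX l * HX m) (HX (l + m))
| heq_bernstein i l f : demazure i l f ->
    heq (HX l * HT i)
        (HT i * HX (wact (s_ rs (simple rs i)) l) + HC (q - q^-1) * HP f).

HB.instance Definition _ := gen_eqMixin hterm.
HB.instance Definition _ := gen_choiceMixin hterm.

Definition heqb (x y : hterm) : bool := `[< heq x y >].

Fact heqb_equiv : equiv_class_of heqb.
Proof.
split=> [x|x y|y x z].
- exact/asboolP/heq_refl.
- by apply/asboolP/asboolP; exact: heq_sym.
- by move=> /asboolP xy /asboolP yz; apply/asboolP; exact: heq_trans xy yz.
Qed.

Canonical heqb_equiv_rel := EquivRelPack heqb_equiv.

Definition hecke := {eq_quot heqb}.
HB.instance Definition _ := Choice.on hecke.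

Definition hpi (x : hterm) : hecke := \pi_hecke x.

Lemma hpiP x y : hpi x = hpi y <-> heq x y.
Proof. by split=> [/eqmodP/asboolP|xy]//; apply/eqmodP/asboolP. Qed.

Lemma hrepr x : heq (repr (hpi x)) x.
Proof. by apply/hpiP; rewrite /hpi reprK. Qed.

Definition hadd (x y : hecke) : hecke := hpi (repr x + repr y).
Definition hmul (x y : hecke) : hecke := hpi (repr x * repr y).
Definition hopp (x : hecke) : hecke := hpi (HC (-1) * repr x).
Definition hscale (c : R[i]) (x : hecke) : hecke := hpi (HC c * repr x).

Lemma hpi_surj (x : hecke) : exists y, x = hpi y.
Proof. by exists (repr x); rewrite /hpi reprK. Qed.

Lemma haddE x y : hadd (hpi x) (hpi y) = hpi (x + y).
Proof. by apply/hpiP/heq_add; exact: hrepr. Qed.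

Lemma hmulE x y : hmul (hpi x) (hpi y) = hpi (x * y).
Proof. by apply/hpiP/heq_mul; exact: hrepr. Qed.

Lemma hoppE x : hopp (hpi x) = hpi (HC (-1) * x).
Proof. by apply/hpiP/heq_mul; [exact: heq_refl|exact: hrepr]. Qed.

Lemma hscaleE c x : hscale c (hpi x) = hpi (HC c * x).
Proof. by apply/hpiP/heq_mul; [exact: heq_refl|exact: hrepr]. Qed.

Fact haddA : associative hadd.
Proof.
move=> x y z; have [[x' ->] [y' ->] [z' ->]] := And3 (hpi_surj x) (hpi_surj y) (hpi_surj z).
by rewrite !haddE; apply/hpiP/heq_addA.
Qed.

Fact haddC : commutative hadd.
Proof.
move=> x y; have [[x' ->] [y' ->]] := conj (hpi_surj x) (hpi_surj y).
by rewrite !haddE; apply/hpiP/heq_addC.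
Qed.

Fact hadd0 : left_id (hpi (HC 0)) hadd.
Proof.
by move=> x; have [x' ->] := hpi_surj x; rewrite haddE; apply/hpiP/heq_add0.
Qed.

Fact haddN : left_inverse (hpi (HC 0)) hopp hadd.
Proof.
move=> x; have [x' ->] := hpi_surj x.
by rewrite hoppE haddE; apply/hpiP/heq_addN.
Qed.

HB.instance Definition _ :=
  GRing.isZmodule.Build hecke haddA haddC hadd0 haddN.

Fact hmulA : associative hmul.
Proof.
move=> x y z; have [[x' ->] [y' ->] [z' ->]] := And3 (hpi_surj x) (hpi_surj y) (hpi_surj z).
by rewrite !hmulE; apply/hpiP/heq_mulA.
Qed.

Fact hmul1l : left_id (hpi (HC 1)) hmul.
Proof.
by move=> x; have [x' ->] := hpi_surj x; rewrite hmulE; apply/hpiP/heq_mul1l.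
Qed.

Fact hmul1r : right_id (hpi (HC 1)) hmul.
Proof.
by move=> x; have [x' ->] := hpi_surj x; rewrite hmulE; apply/hpiP/heq_mul1r.
Qed.

Fact hmulDl : left_distributive hmul hadd.
Proof.
move=> x y z; have [[x' ->] [y' ->] [z' ->]] := And3 (hpi_surj x) (hpi_surj y) (hpi_surj z).
by rewrite !(haddE, hmulE); apply/hpiP/heq_mulDl.
Qed.

Fact hmulDr : right_distributive hmul hadd.
Proof.
move=> x y z; have [[x' ->] [y' ->] [z' ->]] := And3 (hpi_surj x) (hpi_surj y) (hpi_surj z).
by rewrite !(haddE, hmulE); apply/hpiP/heq_mulDr.
Qed.

(* hecke is not the zero ring: it has the character T_i |-> q, X^l |-> chi l
   where chi alpha_i = q ^ 2 for all i.  For the junk value q = 0 use 1. *)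
Section Nontrivial.
Let q' : R[i] := if q == 0 then 1 else q.

Let q'_neq0 : q' != 0.
Proof. by rewrite /q'; case: (eqVneq q 0) => // _; exact: oner_neq0. Qed.

Let q'E : q' - q'^-1 = q - q^-1.
Proof. by rewrite /q'; case: (eqVneq q 0) => // ->; rewrite invr1 invr0 !subrr. Qed.

Fact hecke_character : exists2 chi : weight rs -> R[i],
  torus chi & forall i, chi (simple_weight rs i) = q' ^+ 2.
Proof.
pose P (l : weight rs) j := Num.floor (ip rs (wval l) (coroot (ip rs) (simple rs j))).
have PE l j : (P l j)%:~R = ip rs (wval l) (coroot (ip rs) (simple rs j)).
  by apply/floorK; have /weight_latticeP := valP l; apply.
have PD l m j : P (l + m) j = P l j + P m j.
  by apply: (@intr_inj R); rewrite rmorphD /= !PE -ipDl.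
pose A := \matrix_(i < n, j < n) P (simple_weight rs i) j.
pose k : 'cV[int]_n := \adj A *m const_mx 2.
have detA : \det A != 0.
  apply/negP => /eqP detA0.
  have : \det (map_mx intr A : 'M[R]_n) = 0 by rewrite det_map_mx detA0.
  move=> /eqP/det0P[v v0 vA].
  case/eqP: v0; apply/rowP => i; rewrite mxE.
  suff E : \sum_i v 0 i *: simple rs i = \sum_i (fun=> 0) i *: simple rs i.
    exact: (simple_free E).
  rewrite [RHS]big1 => [|? _]; last by rewrite scale0r.
  apply: ip_simple_eq0 => j; rewrite ip_suml.
  have /rowP/(_ j) := vA; rewrite !mxE => vAj; apply: etrans vAj.
  apply: eq_bigr => i' _.
  by rewrite ipZl !mxE PE.
have [r r0 rE] : exists2 r : R[i], r != 0 & r ^ (\det A) = q'.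
  have root d : exists2 r : R[i], r != 0 & r ^+ d.+1 = q'.
    exists (d.+1.-root q'); last exact: rootCK.
    by rewrite rootC_eq0.
  case: (\det A) detA => [[|d]|d] // _; first by have [r] := root d; exists r.
  have [r r0 rE] := root d; exists r^-1; first by rewrite invr_eq0.
  by rewrite NegzE -exprnN exprVn invrK.
exists (fun l => r ^ (\sum_j P l j * k j 0)).
  split=> [l|l m]; first exact: expfz_neq0.
  rewrite -expfzDr // -big_split; congr (_ ^ _); apply: eq_bigr => j _ /=.
  by rewrite PD mulrDl.
move=> i; transitivity (r ^ (\det A * 2)).
  congr (_ ^ _).
  have : A *m k = (\det A)%:M *m const_mx 2 by rewrite mulmxA mul_mx_adj.
  rewrite mul_scalar_mx => /matrixP/(_ i 0); rewrite !mxE => <-.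
  by apply: eq_bigr => j _; rewrite [A i j]mxE.
by rewrite -exprz_exp rE.
Qed.


Fact hecke_nontrivial : ~ heq (HC 1) (HC 0).
Proof.
have [chi [chi0 chiD] chia] := hecke_character.
pose fix ev x := match x with
  | HC c => c | HT _ => q' | HX l => chi l
  | HAdd x y => ev x + ev y | HMul x y => ev x * ev y end%R.
have evP p : ev (HP p) = mmap id chi p.
  by rewrite /HP (big_morph ev (id1 := 0) (op1 := +%R)).
have evBraid i j m : ev (HBraid i j m) = q' ^+ m.
  rewrite /HBraid (big_morph ev (id1 := 1) (op1 := *%R)) //=.
  by rewrite prodr_const card_ord.
have mmapB p1 p2 : mmap id chi (p1 - p2) = mmap id chi p1 - mmap id chi p2.
  exact: (raddfB (mmap (idfun : {additive R[i] -> R[i]}) chi)).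
have mmapX m p : mmap id chi (mulX m p) = mmap id chi p * chi m.
  rewrite /mulX (raddf_sum (mmap (idfun : {additive R[i] -> R[i]}) chi)) /=.
  rewrite /mmap mulr_suml; apply: eq_bigr => l _.
  by rewrite -/(mmap _ _ _) (mmapU (f := idfun)) chiD mulrA.
suff H x y : heq x y -> ev x = ev y by move/H/eqP; rewrite oner_eq0.
elim=> //= {x y}.
- by move=> x y z _ -> _ ->.
- by move=> x x' y y' _ -> _ ->.
- by move=> x x' y y' _ -> _ ->.
- by move=> *; rewrite addrA.
- by move=> *; rewrite addrC.
- by move=> *; rewrite add0r.
- by move=> *; rewrite mulN1r addNr.
- by move=> *; rewrite mulrA.
- by move=> *; rewrite mul1r.
- by move=> *; rewrite mulr1.
- by move=> *; rewrite mulrDl.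
- by move=> *; rewrite mulrDr.
- by move=> *; rewrite mulrC.
- by move=> i; rewrite -q'E mulrBl mulVf // subrK.
- by move=> i j m _ _; rewrite !evBraid.
- by apply: (mulfI (chi0 0)); rewrite -chiD addr0 mulr1.
- move=> i l f /(congr1 (mmap id chi)); rewrite !mmapB mmapX evP.
  rewrite !(mmapU (f := idfun)) !mul1r -q'E.
  have -> : chi (- simple_weight rs i) = q' ^- 2.
    apply: (mulfI (chi0 (simple_weight rs i))).
    rewrite -chiD subrr chia mulfV ?expf_neq0 //.
    by apply: (mulfI (chi0 0)); rewrite -chiD addr0 mulr1.
  set F := mmap id chi f => FE.
  rewrite [q' * _]mulrC -[chi l](subrK (chi (wact (s_ rs (simple rs i)) l))) -FE.
  by field.
Qed.

End Nontrivial.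

Fact hecke_one_neq0 : hpi (HC 1) != 0.
Proof. by apply/eqP => /hpiP/hecke_nontrivial. Qed.

HB.instance Definition _ := GRing.Zmodule_isNzRing.Build hecke
  hmulA hmul1l hmul1r hmulDl hmulDr hecke_one_neq0.

Fact hscaleA a b x : hscale a (hscale b x) = hscale (a * b) x.
Proof.
have [x' ->] := hpi_surj x; rewrite !hscaleE; apply/hpiP.
apply: heq_trans (heq_mulA _ _ _) _.
by apply: heq_mul; [apply/heq_sym/heq_constM|exact: heq_refl].
Qed.

Fact hscale1 : left_id 1 hscale.
Proof.
by move=> x; have [x' ->] := hpi_surj x; rewrite hscaleE; apply/hpiP/heq_mul1l.
Qed.

Fact hscaleDr : right_distributive hscale +%R.
Proof.
move=> a x y; have [[x' ->] [y' ->]] := conj (hpi_surj x) (hpi_surj y).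
rewrite -[LHS]/(hscale _ (hadd _ _)) -[RHS]/(hadd (hscale _ _) (hscale _ _)).
by rewrite !(haddE, hscaleE); apply/hpiP/heq_mulDr.
Qed.

Fact hscaleDl x : {morph hscale^~ x : a b / a + b}.
Proof.
move=> a b; have [x' ->] := hpi_surj x.
rewrite -[RHS]/(hadd (hscale _ _) (hscale _ _)) !(haddE, hscaleE); apply/hpiP.
apply: heq_trans (heq_mulDl _ _ _).
by apply: heq_mul; [exact: heq_constD|exact: heq_refl].
Qed.

HB.instance Definition _ := GRing.Zmodule_isLmodule.Build (R[i]) hecke
  hscaleA hscale1 hscaleDr hscaleDl.

Fact hscaleAl (a : R[i]) (x y : hecke) : a *: (x * y) = a *: x * y.
Proof.
have [[x' ->] [y' ->]] := conj (hpi_surj x) (hpi_surj y).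
rewrite -[LHS]/(hscale _ (hmul _ _)) -[RHS]/(hmul (hscale _ _) _).
by rewrite !(hmulE, hscaleE); apply/hpiP/heq_mulA.
Qed.

HB.instance Definition _ := GRing.Lmodule_isLalgebra.Build (R[i]) hecke hscaleAl.

Fact hscaleAr (a : R[i]) (x y : hecke) : a *: (x * y) = x * (a *: y).
Proof.
have [[x' ->] [y' ->]] := conj (hpi_surj x) (hpi_surj y).
rewrite -[LHS]/(hscale _ (hmul _ _)) -[RHS]/(hmul _ (hscale _ _)).
rewrite !(hmulE, hscaleE); apply/hpiP.
apply: heq_trans (heq_mulA _ _ _) _; apply: heq_trans (heq_sym (heq_mulA _ _ _)).
by apply: heq_mul; [exact: heq_constC|exact: heq_refl].
Qed.

HB.instance Definition _ := GRing.Lalgebra_isAlgebra.Build (R[i]) hecke hscaleAr.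

Definition hT (i : 'I_n) : hecke := hpi (HT i).
Definition hX (l : weight rs) : hecke := hpi (HX l).

Lemma hpi_const c : hpi (HC c) = c%:A.
Proof.
rewrite -[RHS]/(hscale _ (hpi (HC 1))) hscaleE; apply/hpiP/heq_sym/heq_mul1r.
Qed.

Lemma hpi_group_algebra p : hpi (HP p) = mmap (in_alg hecke) hX p.
Proof.
rewrite /HP /mmap (big_morph hpi (id1 := 0) (op1 := +%R)) // => [|x y].
  by apply: eq_bigr => l _; rewrite -hmulE hpi_const.
by rewrite -haddE.
Qed.

Lemma hT_quadratic i : hT i ^+ 2 = (q - q^-1) *: hT i + 1.
Proof.
rewrite -[LHS]/(hmul (hpi _) (hpi _)) hmulE.
rewrite -[RHS]/(hadd (hscale _ (hpi _)) (hpi _)) hscaleE haddE.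
exact/hpiP/heq_quadratic.
Qed.

Lemma hX0 : hX 0 = 1.
Proof. exact/hpiP/heq_X0. Qed.

Lemma hXD l m : hX (l + m) = hX l * hX m.
Proof. by rewrite -[RHS]/(hmul (hpi _) (hpi _)) hmulE; apply/hpiP/heq_sym/heq_XD. Qed.

Lemma hX_hT l i f : demazure i l f ->
  hX l * hT i = hT i * hX (wact (s_ rs (simple rs i)) l)
                + (q - q^-1) *: mmap (in_alg hecke) hX f.
Proof.
move=> lf; rewrite -hpi_group_algebra.
rewrite -[LHS]/(hmul (hpi _) (hpi _)) hmulE.
rewrite -[RHS]/(hadd (hmul (hpi _) (hpi _)) (hscale _ (hpi _))).
by rewrite hmulE hscaleE haddE; apply/hpiP/heq_bernstein.
Qed.

Lemma hT_braid i j m : i != j ->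
  has_order (s_ rs (simple rs i) \o s_ rs (simple rs j))%VF m ->
  \prod_(k < m) hT (if odd k then j else i) =
  \prod_(k < m) hT (if odd k then i else j).
Proof.
have hB i' j' : \prod_(k < m) hT (if odd k then j' else i') = hpi (HBraid i' j' m).
  rewrite /HBraid (big_morph hpi (id1 := 1) (op1 := *%R)) // => x y.
  by rewrite -hmulE.
by move=> ij ijm; rewrite !hB; apply/hpiP/heq_braid.
Qed.

End Hecke.

Section GeneratedSubalgebra.
Variables (K : comNzRingType) (A : algType K) (S : set A).

Definition gen_subalg : {pred A} := fun x =>
  `[< forall B : subalgClosed A, (forall y, S y -> y \in B) -> x \in B >].

Fact gen_subalg_closed : GRing.subsemialg_closed gen_subalg.
Proof.
split.
- by apply/asboolP => B _; exact: rpred1.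
- split=> [|x y /asboolP xS /asboolP yS]; apply/asboolP => B SB.
    exact: rpred0.
  by rewrite rpredD // (xS, yS).
- by move=> a x /asboolP xS; apply/asboolP => B SB; rewrite rpredZ // xS.
- move=> x y /asboolP xS /asboolP yS; apply/asboolP => B SB.
  by rewrite rpredM // (xS, yS).
Qed.

HB.instance Definition _ :=
  GRing.isSubalgClosed.Build K A gen_subalg gen_subalg_closed.

Record subalg := Subalg { subalg_val : A; _ : subalg_val \in gen_subalg }.

HB.instance Definition _ := [isSub for subalg_val].
HB.instance Definition _ := [Choice of subalg by <:].
HB.instance Definition _ := [SubChoice_isSubAlgebra of subalg by <:].

Lemma mem_gen_subalg x : S x -> x \in gen_subalg.
Proof. by move=> Sx; apply/asboolP => B; apply. Qed.

End GeneratedSubalgebra.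

(* A module over a K-algebra A is a K-vector space through c |-> c%:A. *)
Section Modules.
Variables (K : comNzRingType) (A : algType K) (M : lmodType A).

(* The subspace U has a basis with d elements. *)
Definition has_dim (U : set M) (d : nat) : Prop :=
  exists b : 'I_d -> M, (forall i, U (b i)) /\
    forall m, U m -> exists! c : {ffun 'I_d -> K}, m = \sum_i (c i)%:A *: b i.

Definition finite_dim : Prop := exists d, has_dim setT d.

Definition irreducible : Prop :=
  (exists m : M, m != 0) /\
  forall N : submodClosed M, (forall m, m \in N -> m = 0) \/ (forall m, m \in N).

End Modules.

Section WeightSpaces.
Variables (R : realType) (V : vectType R) (n : nat) (rs : rootSystem V n).
Variables (A : algType (R[i])) (X : weight rs -> A) (M : lmodType A).

Definition weight_space (t : weight rs -> R[i]) : set M :=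
  [set m | forall l, X l *: m = (t l)%:A *: m].

Definition gen_weight_space (t : weight rs -> R[i]) : set M :=
  [set m | forall l, exists2 k, (0 < k)%N & (X l - (t l)%:A) ^+ k *: m = 0].

Definition calibrated : Prop :=
  finite_dim M /\ forall t, torus t -> gen_weight_space t = weight_space t.

End WeightSpaces.

Section Skew.
Variables (R : realType) (V : vectType R) (n : nat) (rs : rootSystem V n).
Variable q : R[i].

Definition central_character (M : lmodType (hecke rs q)) (t : weight rs -> R[i])
    : Prop :=
  torus t /\ forall p : group_algebra rs, invariant p -> forall m : M,
    mmap (in_alg (hecke rs q)) (@hX _ _ _ rs q) p *: m = (mmap id t p)%:A *: m.

Definition gens2 (i j : 'I_n) : set (hecke rs q) :=
  [set x | [\/ x = hT rs q i, x = hT rs q j | exists l, x = hX q l]].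

Definition hecke2 (i j : 'I_n) := subalg (gens2 i j).
HB.instance Definition _ i j := GRing.Algebra.on (hecke2 i j).

Definition hecke2_X (i j : 'I_n) (l : weight rs) : hecke2 i j :=
  Subalg (mem_gen_subalg (Or33 _ _ (ex_intro _ l erefl) : gens2 i j (hX q l))).

Definition calibratable (t : weight rs -> R[i]) : Prop :=
  forall i j, exists M : lmodType (hecke2 i j),
    calibrated (hecke2_X i j) M /\
    exists2 m : M, m != 0 & weight_space (hecke2_X i j) t m.

Definition skew_local_region (t : weight rs -> R[i]) (J : set (weight rs)) : Prop :=
  local_region q t J /\ forall w, Fset q t J w -> calibratable (tact w t).

End Skew.

(* Main.v *)
From HB Require Import structures.
Require Import Defs.
From mathcomp Require Import all_boot all_order all_algebra fingroup perm.
From mathcomp Require Import ring lra zify.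
From mathcomp Require Import finmap monalg.
From mathcomp Require Import complex boolp classical_sets reals.
From mathcomp Require Import sequences exp trigo.

(**
A calibrated module cannot have a weight t' with t'(X^alpha_i) = 1, since T_i would
create a Jordan block there.  Hence on weight vectors of M the intertwiners
tau_i m = T_i m - (q - q^-1) / (1 - X^-alpha_i) m are always defined, they map M_ut
to M_(s_i u)t, and tau_i tau_i is a scalar which vanishes exactly when
(ut)(X^alpha_i) = q^2 or q^-2.  Since a non-reduced word in the T_i is a combination
of shorter words, M is spanned by the vectors tau_s m for s a reduced word and m a
fixed weight vector, and tau_s m has weight (word s) u t.  Weights that avoid Z(t)
determine their Weyl group element (Steinberg), so M_ut is spanned by m alone, and
the only way back from tau_i m to m is tau_i; by irreducibility a nonzero tau_i never
crosses a root of P(t).  Conversely, off Z(t) and P(t) the tau_i are invertible, so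
the weights of M fill out one local region.

Steinberg's theorem is proved for t = exp (y + 2 pi i x): w t = t means that w x - x
is in the coroot lattice and w y = y; a small perturbation of x, fixed by w modulo the
coroot lattice, is regular, and its shortest translate c satisfies |<c, b>| < 1 for
all roots b, so that w c - c is minuscule in the coroot lattice, hence 0.
*)

Set Implicit Arguments.
Unset Strict Implicit.
Unset Printing Implicit Defensive.

Import Order.TTheory GRing.Theory Num.Theory.

Local Open Scope classical_set_scope.
Local Open Scope ring_scope.

(** The stabilizer of [t] in the Weyl group may be nontrivial, so a weight of M does not by itself
    name a Weyl group element; avoiding Z(t) repairs this. Each point of the orbit has a
    representative that keeps the roots of Z(t) positive, and two such representatives differ by an
    element to which [torus_stabilizer] applies.

    The perturbation of x must stay fixed by w modulo the coroot lattice and yet leave every wall.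
    Multiples of y deal with the roots on which y is nonzero. For the roots on which t is 1, the sum
    of the orbit of rho under the powers of w serves: w fixes it, and it pairs positively with the
    positive ones among them because w keeps these positive.

    Products of tau_i differ from products of T_i by shorter words; through this comparison the
    braid relations, by way of Matsumoto's theorem, act on the tau_i. The set J is R(u) intersected
    with P(t) for any such representative u of a weight, whence its uniqueness. Skewness comes from
    restricting M itself to the subalgebras generated by T_i, T_j and X. *)

Lemma ltn_sub_count (T : eqType) (p1 p2 : pred T) s x :
  (forall y, p1 y -> p2 y) -> x \in s -> p2 x -> ~~ p1 x ->
  (count p1 s < count p2 s)%N.
Proof.
move=> p12 + p2x /negPf p1x; elim: s => //= y s IH.
rewrite inE => /orP[/eqP<-|/IH {}IH]; first by rewrite p2x p1x ltnS sub_count.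
by rewrite -addnS leq_add //; have := p12 y; case: (p1 y) => // ->.
Qed.

(** * The Weyl group as a group of isometries permuting the roots *)

Section WeylGroup.
Variables (R : realType) (V : vectType R) (n : nat) (rs : rootSystem V n).
Local Notation ip := (ip rs).
Local Notation al := (simple rs).
Local Notation S := (s_ rs).
Local Notation rf := (refl rs).
Local Notation Phi := (Defs.roots rs).
Local Notation Sa i := (S (al i)).

Lemma s_E a v : S a v = rf a v.
Proof. by rewrite lfunE. Qed.

Lemma s_K a : a \in Phi -> involutive (S a).
Proof. by move=> ar v; rewrite !s_E reflK. Qed.

Lemma refl_self a : a \in Phi -> rf a a = - a.
Proof.
move=> ar; rewrite /refl /reflection ip_coroot divfK ?gt_eqF ?ip_root_gt0 //.
by rewrite mulr2n scalerDl scale1r opprD addrA subrr sub0r.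
Qed.

Lemma root_opp a : a \in Phi -> - a \in Phi.
Proof. by move=> ar; rewrite -refl_self //; exact: roots_reflection. Qed.

Lemma weyl_comp u w : weyl rs u -> weyl rs w -> weyl rs (u \o w)%VF.
Proof.
elim=> [|a {}u ar _ IH] ww; first by rewrite comp_lfun1l.
by rewrite -comp_lfunA; apply: weylM => //; exact: IH.
Qed.

Lemma ip_weyl w : weyl rs w -> forall u v, ip (w u) (w v) = ip u v.
Proof.
elim=> [|a {}w ar _ IH] u v; first by rewrite !id_lfunE.
by rewrite !comp_lfunE !s_E ip_refl // IH.
Qed.

Lemma ip_inj u v : (forall x, ip u x = ip v x) -> u = v.
Proof.
move=> uv; apply/eqP; rewrite -subr_eq0; apply/negPn/negP => /(ip_pos rs).
by rewrite ipBl uv subrr ltxx.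
Qed.

Lemma weyl_lker0 w : weyl rs w -> lker w == 0%VS.
Proof.
move=> ww; apply/lker0P => u v wuv; apply: ip_inj => x.
by rewrite -(ip_weyl ww) wuv ip_weyl.
Qed.

Lemma weylK w : weyl rs w -> cancel w (w^-1)%VF.
Proof. by move=> ww; apply: lker0_lfunK; exact: weyl_lker0. Qed.

Lemma weylVK w : weyl rs w -> cancel (w^-1)%VF w.
Proof.  by move=> ww; apply: lker0_lfunVK; exact: weyl_lker0. Qed.

Lemma weyl_inj w : weyl rs w -> injective w.
Proof. by move/weylK/can_inj. Qed.

Lemma weylV w : weyl rs w -> weyl rs (w^-1)%VF.
Proof.
move=> ww.
suff [w' ww' w'K] : exists2 w', weyl rs w' & forall v, w' (w v) = v.
  suff -> : (w^-1)%VF = w' by [].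
  by apply/lfunP => v; rewrite -[v in RHS](weylVK ww) w'K.
elim: ww => [|a {}w ar _ [w' ww' w'K]].
  by exists \1%VF; [exact: weyl1|move=> v; rewrite !id_lfunE].
exists (w' \o S a)%VF; first by apply: weyl_comp => //; exact: weyl_s.
by move=> v; rewrite !comp_lfunE s_K.
Qed.

Lemma ip_weylV w : weyl rs w -> forall u v, ip (w u) v = ip u ((w^-1)%VF v).
Proof. by move=> ww u v; rewrite -{1}[v](weylVK ww) ip_weyl. Qed.

Lemma weyl_root w a : weyl rs w -> (w a \in Phi) = (a \in Phi).
Proof.
have im u b : weyl rs u -> b \in Phi -> u b \in Phi.
  elim=> [|c {}u cr _ IH] br; first by rewrite id_lfunE.
  by rewrite comp_lfunE s_E; apply: roots_reflection => //; exact: IH.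
move=> ww; apply/idP/idP => [wa|]; last exact: im.
by rewrite -[a](weylK ww); apply: im => //; exact: weylV.
Qed.

Lemma coroot_weyl w a : weyl rs w -> coroot ip (w a) = w (coroot ip a).
Proof. by move=> ww; rewrite /coroot ip_weyl // linearZ. Qed.

Lemma s_weyl w a v : weyl rs w -> S (w a) (w v) = w (S a v).
Proof.
move=> ww; rewrite !s_E /refl /reflection coroot_weyl // ip_weyl //.
by rewrite linearB [in RHS]linearZ.
Qed.

(** * Positivity *)

(* Pairing with the sum of the fundamental weights detects the sign of a root. *)
Definition rho : V := \sum_i fweight rs i.

Lemma ip_rho_simple i : 0 < ip rho (al i).
Proof.
have : ip rho (coroot ip (al i)) = 1.
  rewrite ip_suml (bigD1 i) //= fweightE eqxx big1 ?addr0 // => j /negPf ji.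
  by rewrite fweightE ji.
rewrite ip_coroot => E; have := ltr01 (R := R).
by rewrite -E pmulr_rgt0 // divr_gt0 // ip_root_gt0 // simple_roots.
Qed.

(** Pairing with omega_i isolates the coefficient of alpha_i; [refl_simple_pos] compares
    coefficients this way. *)
Lemma simple_coefE (c : 'I_n -> R) i :
  ip (fweight rs i) (\sum_j c j *: al j) = c i * (ip (al i) (al i) / 2).
Proof.
have E j : ip (fweight rs i) (al j) = (i == j)%:R * (ip (al j) (al j) / 2).
  rewrite -(fweightE rs) ip_coroot.
  have := ip_root_gt0 (simple_roots rs j) => /lt0r_neq0 x0.
  by field.
rewrite ip_sym ip_suml (bigD1 i) //= big1 ?addr0 => [|j /negPf ji].
  by rewrite ipZl ip_sym E eqxx mul1r.
by rewrite ipZl ip_sym E eq_sym ji mul0r mulr0.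
Qed.

Lemma root_sign a : a \in Phi -> positive_root rs a \/ positive_root rs (- a).
Proof.
move=> ar; have [c [E|E]] := simple_sign ar; [left|right]; split=> //.
- by exists c.
- by rewrite root_opp.
- by exists c; rewrite E opprK.
Qed.

Lemma positive_rho a : positive_root rs a -> 0 < ip rho a.
Proof.
move=> [ar [c E]].
have c0 i : 0 <= ip rho ((c i)%:R *: al i).
  by rewrite ipZr mulr_ge0 ?ler0n // ltW // ip_rho_simple.
have E' : ip rho a = \sum_i ip rho ((c i)%:R *: al i).
  by rewrite E ip_sym ip_suml; apply: eq_bigr => i _; rewrite ip_sym.
rewrite lt_neqAle E' sumr_ge0 // andbT; apply: contraTneq ar => /esym/eqP.
rewrite psumr_eq0 // => /allP c00; apply: contraNN (roots_neq0 rs).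
suff -> : a = 0 by [].
rewrite E big1 // => i _; have := c00 i (mem_index_enum i).
by rewrite ipZr mulf_eq0 (gt_eqF (ip_rho_simple i)) orbF => /eqP->; rewrite scale0r.
Qed.

Lemma positiveE a : a \in Phi -> positive_root rs a <-> 0 < ip rho a.
Proof.
move=> ar; split; first exact: positive_rho.
have [//|/positive_rho] := root_sign ar.
by rewrite ipNr oppr_gt0 => /lt_trans h /h; rewrite ltxx.
Qed.

Lemma negativeE a : a \in Phi -> negative_root rs a <-> ip rho a < 0.
Proof. by move=> ar; rewrite /negative_root positiveE ?root_opp // ipNr oppr_gt0. Qed.

Lemma ip_rho_neq0 a : a \in Phi -> ip rho a != 0.
Proof.
move=> /root_sign[/positive_rho/lt0r_neq0//|/positive_rho/lt0r_neq0].
by rewrite ipNr oppr_eq0.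
Qed.

(** By reducedness a positive root other than alpha_i involves a second simple root, whose
    coefficient s_i leaves unchanged; one positive coefficient forces a root to be positive. *)
Lemma refl_simple_pos i a : a \in Phi -> 0 < ip rho a -> a != al i ->
  0 < ip rho (rf (al i) a).
Proof.
move=> ar /(positiveE ar)[_ [c E]] ai.
have sr : rf (al i) a \in Phi.
  by apply: roots_reflection => //; exact: simple_roots.
apply/positiveE => //.
have [j ji cj] : exists2 j, j != i & (0 < c j)%N.
  apply: contrapT => h; move/negP: ai; apply; apply/eqP.
  have aE : a = (c i)%:R *: al i.
    rewrite E (bigD1 i) //= big1 ?addr0 // => j ji; case: (posnP (c j)) => [->|cj].
      by rewrite scale0r.
    by case: h; exists j.
  have := roots_reduced (simple_roots rs i) (c := (c i)%:R); rewrite -aE.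
  move=> /(_ ar)[|] c1; first by rewrite aE c1 scale1r.
  by have := ler0n R (c i); rewrite c1 oppr_ge0 ler10.
have [//|[_ [d dE]]] := root_sign sr.
have wj : ip (fweight rs j) (al i) = 0.
  have := simple_coefE (fun k => (k == i)%:R) j; rewrite (negPf ji) mul0r.
  by rewrite (bigD1 i) //= eqxx scale1r big1 ?addr0 // => k /negPf ->; rewrite scale0r.
have := simple_coefE (fun i => (d i)%:R) j; rewrite -dE ipNr /refl /reflection.
rewrite ipBr ipZr wj mulr0 subr0 E simple_coefE.
have x0 : 0 < ip (al j) (al j) / 2 by rewrite divr_gt0 // ip_root_gt0 // simple_roots.
move=> /eqP; rewrite eqr_oppLR -mulNr => /eqP/(mulIf (lt0r_neq0 x0)) /eqP.
by rewrite gt_eqF // (@le_lt_trans _ _ 0) ?oppr_le0 ?ler0n ?ltr0n.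
Qed.

(** Since <a, a> > 0, some simple root in the support of a pairs positively with a, and its
    reflection lowers the pairing with [rho]. The descent ends because it is measured by the number
    of roots below a. *)
Lemma positive_ind (P : V -> Prop) :
  (forall i, P (al i)) ->
  (forall i a, positive_root rs a -> P (rf (al i) a) -> P a) ->
  forall a, positive_root rs a -> P a.
Proof.
move=> Ps Pr a; have [h] := ubnP (count (fun b => ip rho b < ip rho a) (Phi)).
elim: h => // h IH in a *; rewrite ltnS => ch ap.
have [ar [c aE]] := ap.
have [[i <-]//|/forallNP nai] := pselect (exists i, al i = a).
have [[i cai]|/forallNP nci] :=
    pselect (exists i, 0 < (c i)%:R * ip a (al i)); last first.
  have := ip_root_gt0 ar; rewrite ltNge => /negP[].
  rewrite {2}aE ip_sym ip_suml sumr_le0 // => i _.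
  by rewrite ipZl ip_sym leNgt; apply/negP/nci.
have ci0 : (0 < c i)%N.
  by rewrite lt0n; apply: contraTneq cai => ->; rewrite mul0r ltxx.
have ai0 : 0 < ip a (al i) by rewrite pmulr_rgt0 // ltr0n in cai.
have br : rf (al i) a \in Phi.
  by apply: roots_reflection => //; exact: simple_roots.
have bp : 0 < ip rho (rf (al i) a).
  by apply: refl_simple_pos => //; [exact/positiveE|apply/eqP => /esym/nai].
have ba : ip rho (rf (al i) a) < ip rho a.
  rewrite /refl /reflection ipBr ipZr gtrBl ip_coroot !mulr_gt0 ?invr_gt0 //.
    by rewrite ip_root_gt0 // simple_roots.
  exact: ip_rho_simple.
apply: (Pr i) => //; apply: IH; last exact/positiveE.
apply: leq_trans ch; apply: (@ltn_sub_count _ _ _ _ (rf (al i) a)) => //.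
  by move=> x /lt_trans; apply.
by rewrite ltxx.
Qed.

(** * Words in the simple reflections *)

Definition word (s : seq 'I_n) : 'End(V) :=
  foldr (fun i w => (Sa i \o w)%VF) \1%VF s.

Lemma word_cons i s v : word (i :: s) v = Sa i (word s v).
Proof. by rewrite /= comp_lfunE. Qed.

Lemma word_cat s s' : word (s ++ s') = (word s \o word s')%VF.
Proof.
by elim: s => [|i s IH] /=; rewrite ?comp_lfun1l // IH comp_lfunA.
Qed.

Lemma weyl_simple i : weyl rs (Sa i).
Proof. exact/weyl_s/simple_roots. Qed.

Lemma simple_K i : involutive (Sa i).
Proof. exact/s_K/simple_roots. Qed.

Lemma simple_self i : Sa i (al i) = - al i.
Proof. by rewrite s_E refl_self // simple_roots. Qed.

Lemma weyl_word s : weyl rs (word s).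
Proof.
by elim: s => [|i s IH]; [exact: weyl1|apply: weylM => //; exact: simple_roots].
Qed.

Lemma s_opp a : S (- a) = S a.
Proof.
by apply/lfunP => v; rewrite !s_E /refl /reflection coroot_opp ipNr scaleNr scalerN opprK.
Qed.

(** [weyl] is generated by the reflections in all roots; [positive_ind] writes each of them as a
    conjugate of a simple one. *)
Lemma weyl_wordP w : weyl rs w -> exists s, w = word s.
Proof.
elim=> [|a {}w ar _ [s ->]]; first by exists [::].
suff [s' ->] : exists s', S a = word s' by exists (s' ++ s); rewrite word_cat.
wlog ap : a ar / positive_root rs a => [h|].
  have [|ap] := root_sign ar; first exact: h.
  by rewrite -s_opp; apply: h => //; rewrite root_opp.
elim/positive_ind: a / ap {ar} => [i|i a _ [s' E]].
  by exists [:: i]; rewrite /= comp_lfun1r.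
exists (i :: s' ++ [:: i]); apply/lfunP => v.
rewrite word_cons word_cat comp_lfunE word_cons id_lfunE -E -s_E.
rewrite s_weyl; last exact: weyl_simple.
by rewrite !simple_K.
Qed.

Lemma word_inv s v : ((word s)^-1)%VF v = word (rev s) v.
Proof.
apply: (weyl_inj (weyl_word s)); rewrite weylVK; last exact: weyl_word.
elim: s v => [|i s IH] v; first by rewrite /= !id_lfunE.
rewrite rev_cons -cats1 word_cat word_cons comp_lfunE -IH word_cons id_lfunE.
by rewrite simple_K.
Qed.

Lemma word_consV i s v :
  ((word (i :: s))^-1)%VF v = ((word s)^-1)%VF (Sa i v).
Proof.
by rewrite !word_inv rev_cons -cats1 word_cat comp_lfunE word_cons id_lfunE.
Qed.

(** Strong exchange condition. As the letters act on b one after another, the root turns negative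
    only at a letter whose simple root it has become, and that letter is deleted. *)
Lemma exchange s b : positive_root rs b -> ip rho (((word s)^-1)%VF b) < 0 ->
  exists2 s', size s = (size s').+1 & word s' = (S b \o word s)%VF.
Proof.
elim: s b => [|j s IH] b bp.
  have -> : ((word [::])^-1)%VF b = b by rewrite word_inv /= id_lfunE.
  by move/lt_trans/(_ (positive_rho bp)); rewrite ltxx.
rewrite word_consV => sb; have [bE|bj] := eqVneq b (al j).
  by exists s => //; apply/lfunP => v; rewrite comp_lfunE word_cons bE simple_K.
have [s' sz E] : exists2 s', size s = (size s').+1 &
    word s' = (S (Sa j b) \o word s)%VF.
  apply: IH => //; rewrite s_E; have br := bp.1.
  apply/positiveE; first by apply: roots_reflection => //; exact: simple_roots.
  exact/refl_simple_pos/bj/positive_rho.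
exists (j :: s'); first by rewrite /= sz.
apply/lfunP => v; rewrite comp_lfunE !word_cons E comp_lfunE.
rewrite -[word s v](simple_K j) s_weyl; last exact: weyl_simple.
by rewrite !simple_K.
Qed.

Definition reduced s := forall s', word s' = word s -> (size s <= size s')%N.

Lemma simple_sgn w i : weyl rs w -> 0 < ip rho (w (al i)) \/ ip rho (w (al i)) < 0.
Proof.
move=> ww; have : ip rho (w (al i)) != 0.
  by rewrite ip_rho_neq0 // weyl_root // simple_roots.
case: (ltgtP (ip rho (w (al i))) 0) => // _ _; [by right|by left].
Qed.

Lemma positive_simple i : positive_root rs (al i).
Proof. by apply/positiveE; rewrite ?simple_roots // ip_rho_simple. Qed.

(** The inverse of the longer element makes alpha_i negative, so [exchange] turns any word for that
    element into a word for [word s] with one letter fewer. *)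
Lemma reduced_cons i s : reduced s -> 0 < ip rho (((word s)^-1)%VF (al i)) ->
  reduced (i :: s).
Proof.
move=> sr p s' s'E; have [s'' sz E] : exists2 s'', size s' = (size s'').+1 &
    word s'' = (Sa i \o word s')%VF.
  apply: exchange; first exact: positive_simple.
  by rewrite s'E word_consV simple_self linearN ipNr oppr_lt0.
rewrite sz /= ltnS; apply: sr; rewrite E s'E; apply/lfunP => v.
by rewrite comp_lfunE word_cons simple_K.
Qed.

Lemma reduced_tail i s : reduced (i :: s) -> reduced s.
Proof. by move=> sr s' E; have := sr (i :: s'); rewrite /= ltnS E; apply. Qed.

Lemma reduced_cons_pos i s : reduced (i :: s) ->
  0 < ip rho (((word s)^-1)%VF (al i)).
Proof.
move=> sr; have [//|neg] := simple_sgn i (weylV (weyl_word s)).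
have [s' sz E] := exchange (positive_simple i) neg.
by have := sr _ E; rewrite /= sz ltnNge -ltnS ltnW.
Qed.

Lemma reduced_ex w : weyl rs w -> exists2 s, reduced s & word s = w.
Proof.
move=> /weyl_wordP[s ->].
pose P k := `[< exists2 s', size s' = k & word s' = word s >].
have exP : exists k, P k by exists (size s); apply/asboolP; exists s.
case: (ex_minnP exP) => k /asboolP[s' sz E] kmin.
exists s' => // s'' E'; rewrite sz; apply: kmin; apply/asboolP.
by exists s''; rewrite // E'.
Qed.

Lemma reduced_size s s' : reduced s -> word s = word s' -> size s = size s' ->
  reduced s'.
Proof. by move=> sr E sz s'' E'; rewrite -sz; apply: sr; rewrite E E'. Qed.

Lemma reduced_eq_size s s' : reduced s -> reduced s' -> word s = word s' ->
  size s = size s'.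
Proof. by move=> sr sr' E; apply/eqP; rewrite eqn_leq sr ?sr'. Qed.

Lemma reduced_catr s s' : reduced (s ++ s') -> reduced s'.
Proof. by elim: s => // i s IH /reduced_tail. Qed.

Lemma descent i s : reduced s -> ip rho (((word s)^-1)%VF (al i)) < 0 ->
  exists s', reduced (i :: s') /\ word (i :: s') = word s.
Proof.
move=> sr neg; have ww : weyl rs (Sa i \o word s)%VF.
  exact: weyl_comp (weyl_simple i) (weyl_word s).
have [s' sr' E] := reduced_ex ww; exists s'; split; last first.
  by apply/lfunP => v; rewrite word_cons E comp_lfunE simple_K.
apply: reduced_cons => //; rewrite E.
have -> : ((Sa i \o word s)^-1)%VF = ((word (i :: s))^-1)%VF by [].
by rewrite word_consV simple_self linearN ipNr oppr_gt0.
Qed.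

Lemma weyl_no_descent w : weyl rs w -> (forall i, 0 < ip rho (w (al i))) ->
  w = \1%VF.
Proof.
move=> ww pos; have [s sr E] := reduced_ex (weylV ww).
have wE : w = ((word s)^-1)%VF.
  apply/lfunP => v; apply: (weyl_inj (weyl_word s)).
  by rewrite weylVK ?E ?weylK //; rewrite -E; exact: weyl_word.
case: s sr E wE => [_ _ ->|i s sr E wE].
  by apply/lfunP => v; rewrite word_inv.
have := pos i; rewrite wE word_consV simple_self linearN ipNr oppr_gt0.
by move/lt_trans/(_ (reduced_cons_pos sr)); rewrite ltxx.
Qed.

End WeylGroup.

(** * Finiteness of the Weyl group, alternating words and Matsumoto's theorem *)

Section Matsumoto.
Variables (R : realType) (V : vectType R) (n : nat) (rs : rootSystem V n).
Local Notation ip := (ip rs).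
Local Notation al := (simple rs).
Local Notation S := (s_ rs).
Local Notation Phi := (Defs.roots rs).
Local Notation Sa i := (S (al i)).
Local Notation rho := (rho rs).
Local Notation word := (word rs).
Local Notation reduced := (reduced rs).

Lemma weyl_eq_on_roots (u w : 'End(V)) : {in Phi, u =1 w} -> u = w.
Proof.
move=> uw; apply/lfunP => v; apply: (span_lfunP Phi u w).2 => //.
by rewrite roots_span memvf.
Qed.

Lemma iter_weyl k w : weyl rs w -> exists2 u, weyl rs u & u =1 iter k w.
Proof.
move=> ww; elim: k => [|k [u uw E]].
  by exists \1%VF; [exact: weyl1|move=> v; rewrite id_lfunE].
by exists (w \o u)%VF; [exact: weyl_comp|move=> v; rewrite comp_lfunE E].
Qed.

Lemma weyl_finite_order w : weyl rs w ->
  exists2 N, (0 < N)%N & forall v, iter N w v = v.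
Proof.
move=> ww.
have wr (x : seq_sub Phi) : w (val x) \in Phi by rewrite weyl_root //; exact: ssvalP.
pose f (x : seq_sub Phi) : seq_sub Phi := SeqSub (wr x).
have finj : injective f.
  by move=> x y /(congr1 val)/= /(weyl_inj ww) /val_inj.
pose p := perm finj; exists #[p]%g; first exact: order_gt0.
have [u _ E] := iter_weyl #[p]%g ww.
move=> v; rewrite -E; suff -> : u = \1%VF by rewrite id_lfunE.
apply: weyl_eq_on_roots => a ar; rewrite id_lfunE E.
have := congr1 (fun q : {perm _} => val (q (SeqSub ar))) (expg_order p).
rewrite permX perm1 /= => {2}<-; elim: #[p]%g => //= k ->.
by rewrite permE.
Qed.

(** An element is determined by the self-map it induces on the roots, and there are finitely many
    such maps. *)
Lemma weyl_finite : exists W : seq 'End(V), uniq W /\ forall w, w \in W <-> weyl rs w.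
Proof.
pose T := seq_sub Phi.
pose Q (f : {ffun T -> T}) w := weyl rs w /\ forall x, w (val x) = val (f x).
pose g f := if pselect (exists w, Q f w) is left h then Some (sval (cid h)) else None.
exists (undup (pmap g (enum {ffun T -> T}))); split=> [|w].
  exact: undup_uniq.
rewrite mem_undup mem_pmap; split=> [/mapP[f _]|ww].
  by rewrite /g; case: pselect => // h [->]; case: cid => u [].
have wr (x : T) : w (val x) \in Phi by rewrite weyl_root //; exact: ssvalP.
apply/mapP; exists [ffun x => SeqSub (wr x)]; first by rewrite mem_enum.
rewrite /g; case: pselect => [h|[]]; last first.
  by exists w; split=> // x; rewrite ffunE.
congr Some; case: cid => u /= [_ uw]; apply: weyl_eq_on_roots => a ar.
by have := uw (SeqSub ar); rewrite ffunE.
Qed.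

Fixpoint alt (i j : 'I_n) m := if m is m'.+1 then i :: alt j i m' else [::].

Definition nxt (i j : 'I_n) k := if odd k then j else i.

Lemma nxtS i j k : nxt i j k.+1 = nxt j i k.
Proof. by rewrite /nxt /=; case: odd. Qed.

Lemma alt_rcons i j m : alt i j m.+1 = rcons (alt i j m) (nxt i j m).
Proof. by elim: m i j => // m IH i j; rewrite nxtS [rcons _ _]/= -IH. Qed.

Lemma size_alt i j m : size (alt i j m) = m.
Proof. by elim: m i j => //= m IH i j; rewrite IH. Qed.

Lemma prod_alt (A : pzSemiRingType) (f : 'I_n -> A) i j m :
  \prod_(k < m) f (if odd k then j else i) = \prod_(x <- alt i j m) f x.
Proof.
elim: m i j => [|m IH] i j; first by rewrite big_ord0 big_nil.
rewrite big_ord_recl big_cons -IH; congr (_ * _).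
by apply: eq_bigr => k _; congr f => /=; case: odd.
Qed.

Lemma iter_swap m i j v : Sa i (iter m (Sa j \o Sa i)%VF v) =
  iter m (Sa i \o Sa j)%VF (Sa i v).
Proof. by elim: m => //= m IH; rewrite !comp_lfunE -IH. Qed.

(** When m is the order of s_i s_j, this becomes the braid relation between the two alternating
    words. *)
Lemma word_alt i j m v :
  word (alt i j m) v = iter m (Sa i \o Sa j)%VF (word (alt j i m) v).
Proof.
elim: m i j v => // m IH i j v; rewrite !word_cons IH iter_swap iterSr.
by rewrite comp_lfunE simple_K.
Qed.

(** The sign can change only where the root b is alpha_i. Then the reflection in b is s_i, so the
    two alternating words of length k agree and [word_alt] gives (s_i s_j)^k = 1. *)
Lemma alt_pos k i j :
  (forall k', (0 < k' <= k)%N -> ~ (forall v, iter k' (Sa i \o Sa j)%VF v = v)) ->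
  0 < ip rho (word (alt i j k) (al (nxt i j k))).
Proof.
elim: k i j => [|k IH] i j ord; first by rewrite id_lfunE ip_rho_simple.
rewrite nxtS word_cons; set b := word _ _.
have br : b \in Phi by rewrite weyl_root ?simple_roots //; exact: weyl_word.
have bp : 0 < ip rho b.
  apply: IH => k' /andP[k'0 k'k] E; apply: (ord k'); first by rewrite k'0 ltnW.
  by move=> v; rewrite -[v](simple_K rs i) -iter_swap E.
rewrite s_E; apply: refl_simple_pos => //; apply/eqP => bi.
have E v : word (alt i j k.+1) v = word (alt j i k.+1) v.
  rewrite word_cons alt_rcons -cats1 word_cat comp_lfunE word_cons id_lfunE.
  by rewrite -bi s_weyl //; exact: weyl_word.
apply: (ord k.+1); first by rewrite ltnSn.
move=> v; rewrite -[v](weylVK (weyl_word rs (alt j i k.+1))).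
by rewrite -word_alt E.
Qed.

Lemma alt_comb k i j : exists a b : R,
  word (alt i j k) (al (nxt i j k)) = a *: al i + b *: al j.
Proof.
elim: k i j => [|k IH] i j.
  by exists 1, 0; rewrite id_lfunE scale1r scale0r addr0.
have [a [b E]] := IH j i; rewrite nxtS word_cons E.
exists (- b - a * ip (al j) (coroot ip (al i))), a.
rewrite linearD !linearZ /= simple_self s_E /refl /reflection.
rewrite scalerBr scalerN scalerBl scaleNr !scalerA [RHS]addrC -addrA.
by congr (_ + _); rewrite addrC.
Qed.

(** The root is positive by [alt_pos] and lies in the plane of alpha_i and alpha_j by [alt_comb]. It
    is thus a nonnegative combination of these two, and w makes both negative. *)
Lemma alt_neg k i j w : i != j -> weyl rs w ->
  (forall k', (0 < k' <= k)%N -> ~ (forall v, iter k' (Sa i \o Sa j)%VF v = v)) ->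
  ip rho (w (al i)) < 0 -> ip rho (w (al j)) < 0 ->
  ip rho (w (word (alt i j k) (al (nxt i j k)))) < 0.
Proof.
move=> ij ww ord wi wj; have := alt_pos ord.
have [a [b E]] := alt_comb k i j.
set c := word _ _ in E *.
have cr : c \in Phi by rewrite weyl_root ?simple_roots //; exact: weyl_word.
move=> /(positiveE cr)[_ [d dE]].
have ed : \sum_k (d k)%:R *: al k = \sum_k (a * (k == i)%:R + b * (k == j)%:R) *: al k.
  rewrite -dE E; under [RHS]eq_bigr do rewrite scalerDl -!scalerA.
  rewrite big_split /= (bigD1 i) //= [X in _ = _ + X](bigD1 j) //= !eqxx !scale1r.
  rewrite !big1 ?addr0 // => k' /negPf ->; by rewrite scale0r scaler0.
have di := simple_free ed i; have dj := simple_free ed j.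
move: di dj; rewrite !eqxx (negPf ij) eq_sym (negPf ij) !mulr0 !mulr1 addr0 add0r.
move=> ai bj; have : ip rho (w c) <= 0.
  rewrite E linearD !linearZ /= ipDr !ipZr -ai -bj.
  by rewrite -[0]addr0 lerD // mulr_ge0_le0 ?ler0n // ltW.
by rewrite le_eqVlt (negPf (ip_rho_neq0 _)) // weyl_root.
Qed.

(** The letters of the alternating word are split off one at a time: by [alt_neg] the next letter is
    a descent of what remains. *)
Lemma dihedral_reduced s i j m : i != j ->
  has_order (Sa i \o Sa j)%VF m -> reduced s ->
  ip rho (((word s)^-1)%VF (al i)) < 0 ->
  ip rho (((word s)^-1)%VF (al j)) < 0 ->
  exists c, reduced (alt i j m ++ c) /\ word (alt i j m ++ c) = word s.
Proof.
move=> ij [_ _ ord] sr si sj.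
suff H k : (k <= m)%N -> exists c, reduced (alt i j k ++ c) /\
    word (alt i j k ++ c) = word s by exact: H.
elim: k => [_|k IH km]; first by exists s.
have [c [cr cE]] := IH (ltnW km).
have neg : ip rho (((word s)^-1)%VF (word (alt i j k) (al (nxt i j k)))) < 0.
  apply: alt_neg => //; first exact: weylV (weyl_word rs s).
  by move=> k' /andP[k'0 k'k]; apply: ord; rewrite k'0 (leq_ltn_trans k'k).
rewrite -cE in neg.
have {}neg : ip rho (((word c)^-1)%VF (al (nxt i j k))) < 0.
  suff <- : ((word (alt i j k ++ c))^-1)%VF (word (alt i j k) (al (nxt i j k))) =
            ((word c)^-1)%VF (al (nxt i j k)) by [].
  apply: (weyl_inj (weyl_word rs (alt i j k ++ c))).
  by rewrite (weylVK (weyl_word rs _)) word_cat comp_lfunE (weylVK (weyl_word rs c)).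
have [c' [c'r c'E]] := descent (reduced_catr cr) neg.
have E : word (alt i j k.+1 ++ c') = word (alt i j k ++ c).
  by rewrite alt_rcons -cats1 -catA /= word_cat c'E -word_cat.
exists c'; rewrite E; split=> //.
apply: (reduced_size cr); first by rewrite E.
rewrite !size_cat !size_alt.
by rewrite -(reduced_eq_size c'r (reduced_catr cr) c'E) addnS.
Qed.

Lemma has_order_ex w : weyl rs w -> exists m, has_order w m.
Proof.
move=> /weyl_finite_order[N N0 NE].
have exP : exists k, (0 < k)%N && `[< forall v, iter k w v = v >].
  by exists N; rewrite N0; apply/asboolP.
case: (ex_minnP exP) => m /andP[m0 /asboolP mE] mmin; exists m; split=> //.
move=> k /andP[k0 km] kE; have := mmin k; rewrite k0 leqNgt km /=.
by move=> /(_ (introT (asboolP _) kE)).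
Qed.

(** Induction on the length. A common first letter is cancelled. If the first letters are i and j,
    both are descents, so [dihedral_reduced] provides the words [alt i j m ++ c] and
    [alt j i m ++ c]: each shares its first letter with one of the given words, and the braid
    relation joins them. *)
Lemma matsumoto (A : pzSemiRingType) (f : 'I_n -> A) :
  (forall i j m, i != j -> has_order (Sa i \o Sa j)%VF m ->
    \prod_(x <- alt i j m) f x = \prod_(x <- alt j i m) f x) ->
  forall s s', reduced s -> reduced s' -> word s = word s' ->
  \prod_(x <- s) f x = \prod_(x <- s') f x.
Proof.
move=> braid s; have [h] := ubnP (size s); elim: h s => // h IH.
move=> [|i a]; rewrite ltnS => ah [|j b] sr s'r E //.
- by have := reduced_eq_size sr s'r E.
- by have := reduced_eq_size sr s'r E.
have cons_case k c d : (size c < h)%N -> reduced (k :: c) -> reduced (k :: d) ->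
    word (k :: c) = word (k :: d) ->
    \prod_(x <- k :: c) f x = \prod_(x <- k :: d) f x.
  move=> ch cr dr cd; rewrite !big_cons; congr (_ * _).
  apply: IH => //; [exact: reduced_tail cr|exact: reduced_tail dr|].
  apply/lfunP => v; apply: (weyl_inj (weyl_simple rs k)).
  by rewrite -!word_cons cd.
have [ij|ij] := eqVneq i j; first by subst j; exact: cons_case.
have [m mo] := has_order_ex (weyl_comp (weyl_simple rs i) (weyl_simple rs j)).
have neg k c : reduced (k :: c) -> ip rho (((word (k :: c))^-1)%VF (al k)) < 0.
  by move=> cr; rewrite word_consV simple_self linearN ipNr oppr_lt0 reduced_cons_pos.
have [c [cr cE]] : exists c, reduced (alt i j m ++ c) /\
    word (alt i j m ++ c) = word (i :: a).
  by apply: dihedral_reduced => //; [exact: neg|rewrite E; exact: neg].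
have cE' : word (alt j i m ++ c) = word (i :: a).
  rewrite -cE !word_cat; apply/lfunP => v; rewrite !comp_lfunE.
  by have [_ mid _] := mo; rewrite [RHS]word_alt mid.
have cr' : reduced (alt j i m ++ c).
  apply: (reduced_size cr); first by rewrite cE cE'.
  by rewrite !size_cat !size_alt.
have [m0 _ _] := mo; case: m m0 mo cr cE cr' cE' => // m _ mo cr cE cr' cE'.
transitivity (\prod_(x <- alt i j m.+1 ++ c) f x); first exact: cons_case.
transitivity (\prod_(x <- alt j i m.+1 ++ c) f x).
  by rewrite !big_cat /= (braid _ _ _ ij mo).
have sz : size a = size b by have [] := reduced_eq_size sr s'r E.
apply: cons_case => //; last by rewrite cE'.
have := reduced_eq_size cr' s'r (etrans cE' E).
by rewrite /= => -[->]; rewrite -sz.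
Qed.

End Matsumoto.

(** * Maxima over sequences, and perturbations that create no integers *)

Lemma seq_argmax (R : realDomainType) (T : eqType) (f : T -> R) (s : seq T) x0 :
  x0 \in s -> exists2 x, x \in s & forall y, y \in s -> f y <= f x.
Proof.
elim: s x0 => // z s IH x0 _; case: s IH => [_|z' s IH].
  by exists z => [|y]; rewrite !inE // => /eqP->.
have [x xs xmax] := IH z' (mem_head _ _).
have [zx|/ltW xz] := leP (f z) (f x).
  by exists x => [|y]; rewrite in_cons ?xs ?orbT // => /orP[/eqP->//|/xmax].
exists z => [|y]; first exact: mem_head.
by rewrite in_cons => /orP[/eqP->//|/xmax/le_trans]; apply.
Qed.

Lemma int_lt2 (R : realType) (x : R) : x \is a Num.int -> x < 2 -> x <= 1.
Proof.
by move=> /intrP[z ->]; rewrite -[2]/(2%:~R) ltr_int lerz1; case: z => [[|[]]|].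
Qed.

Lemma perturb_real (R : realType) (p r : R) :
  exists2 e0, 0 < e0 & forall e, 0 < e < e0 -> p + e * r \is a Num.int ->
    p \is a Num.int /\ r = 0.
Proof.
have [->|r0] := eqVneq r 0.
  by exists 1 => // e _; rewrite mulr0 addr0.
wlog : p r r0 / 0 < r => [h|{}r0].
  have [|rn|r0'] := ltgtP 0 r; [exact: h| |by rewrite -r0' eqxx in r0].
  have [||e0 e0p H] := h (- p) (- r); rewrite ?oppr_eq0 ?oppr_gt0 //.
  exists e0 => // e /H; rewrite mulrN -opprD !rpredN => h' /h'[-> /eqP].
  by rewrite oppr_eq0 => /eqP.
(* At this value p + e * r reaches the first integer above p. *)
exists (((Num.floor p + 1)%:~R - p) / r).
  by rewrite divr_gt0 // subr_gt0 floorD1_gt.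
move=> e /andP[e0]; rewrite ltr_pdivlMr // ltrBrDl => e1 /intrP[z zE].
have : ((Num.floor p)%:~R : R) < z%:~R.
  by rewrite -zE (le_lt_trans (floor_le p)) // ltrDl mulr_gt0.
by move: e1; rewrite zE !ltr_int ltzD1 leNgt => /negPf->.
Qed.

(** The induction keeps all sufficiently small e, so that two bounds can be combined by their
    minimum. *)
Lemma perturb (R : realType) (T : eqType) (p r : T -> R) (s : seq T) :
  exists e, forall a, a \in s -> p a + e * r a \is a Num.int ->
    p a \is a Num.int /\ r a = 0.
Proof.
suff [e0 e0p H] : exists2 e0, 0 < e0 & forall e a, 0 < e < e0 -> a \in s ->
    p a + e * r a \is a Num.int -> p a \is a Num.int /\ r a = 0.
  exists (e0 / 2) => a; apply: H.
  by rewrite divr_gt0 //= ltr_pdivrMr // mulr2n mulrDr mulr1 ltrDl.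
elim: s => [|a s [e0 e0p IH]]; first by exists 1.
have [e1 e1p H] := perturb_real (p a) (r a).
exists (Num.min e0 e1); first by rewrite lt_min e0p.
move=> e b /andP[ep]; rewrite lt_min => /andP[ee0 ee1].
by rewrite in_cons => /orP[/eqP->|bs]; [apply: H|apply: IH]; rewrite // ep.
Qed.

(** * The coroot lattice and the free action off the affine walls *)

Section AffineWeyl.
Variables (R : realType) (V : vectType R) (n : nat) (rs : rootSystem V n).
Local Notation ip := (ip rs).
Local Notation al := (simple rs).
Local Notation S := (s_ rs).
Local Notation Phi := (Defs.roots rs).
Local Notation Sa i := (S (al i)).
Local Notation rho := (rho rs).

(** The point u c of the orbit with the largest pairing with [rho] is dominant. The conjugate of w
    that fixes it keeps the simple roots positive. *)
Lemma weyl_regular c w : weyl rs w -> (forall b, b \in Phi -> ip c b != 0) ->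
  w c = c -> w = \1%VF.
Proof.
move=> ww creg wc; have [W [_ WE]] := weyl_finite rs.
have [u /WE uw umax] : exists2 u, u \in W & forall u', u' \in W ->
    ip (u' c) rho <= ip (u c) rho.
  by apply: (@seq_argmax _ _ _ _ \1%VF); apply/WE; exact: weyl1.
set d := u c in umax.
have dreg b : b \in Phi -> ip d b != 0.
  by move=> br; rewrite (ip_weylV uw) creg // weyl_root //; exact: weylV.
have di i : 0 < ip d (al i).
  rewrite lt_neqAle eq_sym dreg ?simple_roots //=.
  have := umax (Sa i \o u)%VF; rewrite WE => /(_ (weyl_comp (weyl_simple rs i) uw)).
  rewrite comp_lfunE s_E /refl /reflection ipBl ipZl gerBl ip_coroot.
  have := ip_rho_simple rs i; rewrite ip_sym => r0.
  rewrite pmulr_lge0 // pmulr_rge0 // divr_gt0 // ip_root_gt0 //.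
  exact: simple_roots.
have dpos a : a \in Phi -> 0 < ip rho a -> 0 < ip d a.
  move=> ar /(positiveE ar)[_ [k aE]].
  rewrite lt_neqAle eq_sym dreg //= aE ip_sym ip_suml sumr_ge0 // => i _.
  by rewrite ipZl ip_sym mulr_ge0 ?ler0n // ltW.
have dneg a : a \in Phi -> 0 < ip d a -> 0 < ip rho a.
  move=> ar da; have [|//|/eqP] := ltgtP (ip rho a) 0; last first.
    by rewrite (negPf (ip_rho_neq0 ar)).
  rewrite -oppr_gt0 -ipNr => /(dpos _ (root_opp ar)).
  by rewrite ipNr oppr_gt0 => /lt_trans/(_ da); rewrite ltxx.
pose v := (u \o w \o (u^-1))%VF.
have vw : weyl rs v by apply: weyl_comp (weylV uw); exact: weyl_comp.
have vd : v d = d by rewrite /v !comp_lfunE (weylK uw) wc.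
have v1 : v = \1%VF.
  apply: (weyl_no_descent vw) => i.
  apply: dneg; first by rewrite weyl_root // simple_roots.
  by rewrite -vd ip_weyl.
apply/lfunP => x; rewrite id_lfunE; apply: (weyl_inj uw).
have : v (u x) = u x by rewrite v1 id_lfunE.
by rewrite /v !comp_lfunE (weylK uw).
Qed.

(** A list of coroots instead of integer coordinates: negative roots supply the signs, and the
    induction of [minuscule_eq0] removes one entry at a time. *)
Definition coroot_lattice (m : V) :=
  exists2 bs : seq V, {subset bs <= Phi} & m = \sum_(b <- bs) coroot ip b.

Lemma coroot_lattice0 : coroot_lattice 0.
Proof. by exists [::] => //; rewrite big_nil. Qed.

Lemma coroot_latticeD x y : coroot_lattice x -> coroot_lattice y ->
  coroot_lattice (x + y).
Proof.
move=> [b bP ->] [c cP ->]; exists (b ++ c); last by rewrite big_cat.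
by move=> a; rewrite mem_cat => /orP[/bP|/cP].
Qed.

Lemma coroot_latticeN x : coroot_lattice x -> coroot_lattice (- x).
Proof.
move=> [b bP ->]; exists (map -%R b).
  by move=> _ /mapP[a /bP ar ->]; exact: root_opp.
by rewrite big_map -sumrN; apply: eq_bigr => a _; rewrite coroot_opp.
Qed.

Lemma coroot_lattice_weyl w x : weyl rs w -> coroot_lattice x ->
  coroot_lattice (w x).
Proof.
move=> ww [b bP ->]; exists (map w b).
  by move=> _ /mapP[a /bP ar ->]; rewrite weyl_root.
by rewrite big_map linear_sum; apply: eq_bigr => a _; rewrite coroot_weyl.
Qed.

Lemma coroot_lattice_coroot a : a \in Phi -> coroot_lattice (coroot ip a).
Proof.
by move=> ar; exists [:: a]; rewrite ?big_seq1 // => b; rewrite inE => /eqP->.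
Qed.

Lemma coroot_latticeMz x z : coroot_lattice x -> coroot_lattice (x *~ z).
Proof.
have H k : coroot_lattice x -> coroot_lattice (x *+ k).
  move=> xl; elim: k => [|k IH]; first by rewrite mulr0n; exact: coroot_lattice0.
  by rewrite mulrS; exact: coroot_latticeD.
case: z => k xl; first exact: H.
by rewrite NegzE mulrNz; apply: coroot_latticeN; exact: H.
Qed.

Lemma ip_coroot_lattice m a : coroot_lattice m -> a \in Phi ->
  ip m a \is a Num.int.
Proof.
move=> [b bP ->] ar; rewrite ip_suml big_seq rpred_sum // => c /bP cr.
by rewrite ip_sym roots_int.
Qed.

Lemma ip_fweight_coroot i a : a \in Phi ->
  ip (fweight rs i) (coroot ip a) \is a Num.int.
Proof.
move=> ar; have wP : fweight rs i \in weight_lattice rs.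
  apply/weight_latticeP => j; rewrite fweightE; exact: natr_int.
have [ap|ap] := root_sign ar; first exact: ip_weight_coroot_pos ap _ wP.
by rewrite -[a]opprK coroot_opp ipNr rpredN; exact: ip_weight_coroot_pos ap _ wP.
Qed.

Lemma coroot_coord m :
  m = \sum_i ip (fweight rs i) m *: coroot ip (al i).
Proof.
apply: (@ip_inj _ _ _ rs) => x; rewrite ip_suml {1}(fweight_coord rs x) ip_sym ip_suml.
by apply: eq_bigr => i _; rewrite !ipZl mulrC ip_coroot [ip x _]ip_sym.
Qed.

Lemma coroot_latticeP m : coroot_lattice m <->
  forall i, ip (fweight rs i) m \is a Num.int.
Proof.
split=> [[b bP ->] i|mint].
  rewrite ip_sym ip_suml big_seq rpred_sum // => c /bP cr.
  by rewrite ip_sym ip_fweight_coroot.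
rewrite [m]coroot_coord; apply: (big_ind coroot_lattice) => [||i _].
- exact: coroot_lattice0.
- exact: coroot_latticeD.
have /intrP[z ->] := mint i; rewrite scaler_int; apply: coroot_latticeMz.
exact/coroot_lattice_coroot/simple_roots.
Qed.

(* A minuscule element of the coroot lattice vanishes: peel coroots off it by
   reflections, which preserve the hypothesis. *)
Lemma minuscule_eq0 m : coroot_lattice m ->
  (forall a, a \in Phi -> ip m a <= 1) -> m = 0.
Proof.
move=> [bs]; have [h] := ubnP (size bs).
elim: h bs m => // h IH bs m; rewrite ltnS => bh bP mE m1.
have [//|m0] := eqVneq m 0.
have [b bb mb] : exists2 b, b \in bs & 0 < ip m (coroot ip b).
  apply: contrapT => nb; have := ip_pos rs m0; rewrite ltNge => /negP[].
  rewrite {1}mE ip_suml big_seq sumr_le0 // => b bb.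
  by rewrite leNgt ip_sym; apply/negP => mb; apply: nb; exists b.
have br := bP _ bb; have b0 := ip_root_gt0 br.
have mb1 : ip m b = 1.
  apply/eqP; rewrite eq_le m1 //=.
  have : ip m b \is a Num.int by apply: ip_coroot_lattice => //; exists bs.
  move: mb; rewrite ip_coroot pmulr_rgt0 ?divr_gt0 // => mb /intrP[z zE].
  by move: mb; rewrite zE ltr0z ler1z gtz0_ge1.
have sE : S b m = m - coroot ip b.
  by rewrite s_E /refl /reflection ip_coroot mb1 mulr1.
apply: (weyl_inj (weyl_s br)); rewrite linear0; apply: (IH (rem b bs)).
- by rewrite (leq_trans _ bh) // size_rem // prednK //; case: (bs) bb.
- by move=> a /mem_rem/bP.
- rewrite sE mE (perm_big _ (perm_to_rem bb)) big_cons /=.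
  by rewrite addrAC subrr add0r.
- move=> a ar; rewrite ip_weylV; last exact: weyl_s.
  by rewrite m1 // weyl_root //; apply: weylV; exact: weyl_s.
Qed.

Lemma cauchy_schwarz u v : ip u v ^+ 2 <= ip u u * ip v v.
Proof.
have ge0 x : 0 <= ip x x.
  by have [->|/(ip_pos rs)/ltW//] := eqVneq x 0; rewrite ip0l.
have [->|u0] := eqVneq u 0; first by rewrite !ip0l mul0r expr0n.
have := ge0 (ip u u *: v - ip u v *: u).
rewrite !(ipBl, ipBr, ipZl, ipZr) [ip v u]ip_sym => h.
have {}h : 0 <= ip u u * (ip u u * ip v v - ip u v ^+ 2) by nra.
by rewrite pmulr_rge0 ?ip_pos // subr_ge0 in h.
Qed.

(** A shortest point of the coset works: if it paired to more than 1 with b, subtracting the coroot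
    of b would shorten it. It exists because only finitely many lattice vectors m fail to make c + m
    longer than c. *)
Lemma coset_min c : exists2 m, coroot_lattice m &
  forall b, b \in Phi -> ip (c + m) b <= 1.
Proof.
have ge0 x : 0 <= ip x x.
  by have [->|/(ip_pos rs)/ltW//] := eqVneq x 0; rewrite ip0l.
(* If |c + m| <= |c| then |m|^2 <= 4 |c|^2, so by Cauchy-Schwarz K bounds the square of each
   coordinate of m. *)
pose K := \sum_i ip (fweight rs i) (fweight rs i) * (4 * ip c c).
pose B := Num.Def.archi_bound K.
(* The shift by B lets ordinals encode the integers from -B to B. *)
pose el (f : {ffun 'I_n -> 'I_(2 * B).+1}) :=
  \sum_i ((f i)%:Z - B%:Z)%:~R *: coroot ip (al i).
have elP f : coroot_lattice (el f).
  apply: (big_ind coroot_lattice) => [||i _].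
  - exact: coroot_lattice0.
  - exact: coroot_latticeD.
  rewrite scaler_int; apply: coroot_latticeMz.
  exact/coroot_lattice_coroot/simple_roots.
pose L := map el (enum {ffun 'I_n -> 'I_(2 * B).+1}).
have memL m : coroot_lattice m -> ip (c + m) (c + m) <= ip c c -> m \in L.
  move=> /coroot_latticeP mint mc.
  have m4 : ip m m <= 4 * ip c c.
    have := ge0 (c + (c + m)); move: mc; rewrite !(ipDl, ipDr) [ip m c]ip_sym.
    lra.
  have bnd i : `|Num.floor (ip (fweight rs i) m)| <= B%:Z.
    have [z zE] := intrP (mint i); rewrite zE intrKfloor.
    have zK : (z%:~R : R) ^+ 2 <= K.
      rewrite -zE (le_trans (cauchy_schwarz _ _)) //.
      rewrite (le_trans (ler_wpM2l (ge0 _) m4)) //.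
      rewrite /K (bigD1 i) //= lerDl sumr_ge0 // => j _.
      by rewrite !mulr_ge0 // ler0n.
    have K0 : 0 <= K by rewrite sumr_ge0 // => j _; rewrite !mulr_ge0.
    (* The absolute value of an integer is at most its square, so K bounds it as well. *)
    rewrite -(ler_int R); apply: le_trans (ltW (archi_boundP K0)).
    apply: le_trans zK; rewrite -rmorphXn /= ler_int.
    rewrite -[z ^+ 2]ger0_norm ?sqr_ge0 // normrX.
    by rewrite expr2; have := normr_ge0 z; nia.
  have fE i : (0 <= Num.floor (ip (fweight rs i) m) + B%:Z <= (2 * B)%:Z)%R.
    by have := bnd i; lia.
  apply/mapP; exists [ffun i => inord (absz (Num.floor (ip (fweight rs i) m) + B%:Z))].
    by rewrite mem_enum.
  rewrite [LHS]coroot_coord; apply: eq_bigr => i _; congr (_ *: _).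
  have /andP[f0 f1] := fE i.
  rewrite ffunE inordK; last by rewrite ltnS -lez_nat gez0_abs.
  by rewrite gez0_abs // addrK floorK.
have [m mL mmax] : exists2 m, m \in L & forall m', m' \in L ->
    - ip (c + m') (c + m') <= - ip (c + m) (c + m).
  apply: (@seq_argmax _ _ _ _ 0); apply: memL; first exact: coroot_lattice0.
  by rewrite addr0.
have mP : coroot_lattice m by have /mapP[f _ ->] := mL.
exists m => // b br; rewrite leNgt; apply/negP => b1.
have b0 := ip_root_gt0 br.
pose m' := m - coroot ip b.
have mm' : ip (c + m') (c + m') < ip (c + m) (c + m).
  rewrite /m' addrA; set x := c + m in b1 *.
  rewrite !(ipBl, ipBr) [ip (coroot ip b) x]ip_sym !ip_coroot.
  rewrite [ip (coroot _ _) b]ip_sym ip_coroot.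
  set y := ip b b in b0 *; have y0 : y != 0 by rewrite gt_eqF.
  rewrite -subr_gt0.
  have -> : ip x x - (ip x x - 2 / y * ip x b -
      (2 / y * ip x b - 2 / y * (2 / y * y))) = 4 / y * (ip x b - 1) by field.
  by rewrite mulr_gt0 ?divr_gt0 // subr_gt0.
have L0 : 0 \in L by apply: memL; rewrite ?addr0 //; exact: coroot_lattice0.
have m'L : m' \in L.
  apply: memL.
    by apply: coroot_latticeD => //; apply/coroot_latticeN/coroot_lattice_coroot.
  have := mmax 0 L0; rewrite addr0 lerN2; apply: le_trans; exact: ltW.
by have := mmax _ m'L; rewrite lerN2 leNgt mm'.
Qed.

(** Off the walls <., b> in Z the affine Weyl group acts freely. The pairings of w c0 - c0 are
    integers below 2, hence at most 1 as [minuscule_eq0] requires; once w fixes c0, [weyl_regular]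
    applies because 0 is an integer. *)
Lemma affine_regular c w : weyl rs w -> coroot_lattice (w c - c) ->
  (forall b, b \in Phi -> ip c b \isn't a Num.int) -> w = \1%VF.
Proof.
move=> ww wc cint; have [m mP m1] := coset_min c.
set c0 := c + m in m1.
have c0int b : b \in Phi -> ip c0 b \isn't a Num.int.
  move=> br; apply: contra (cint b br) => h.
  by rewrite -[c](addrK m) ipBl rpredB // ip_coroot_lattice.
have c01 b : b \in Phi -> ip c0 b < 1.
  move=> br; rewrite lt_neqAle m1 // andbT.
  by apply: contraNneq (c0int b br) => ->; exact: rpred1.
have muP : coroot_lattice (w c0 - c0).
  have -> : w c0 - c0 = (w c - c) + (w m - m).
    by rewrite /c0 linearD /= opprD addrACA.
  apply: coroot_latticeD => //; apply: coroot_latticeD.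
    exact: coroot_lattice_weyl.
  exact: coroot_latticeN.
have mu0 : w c0 - c0 = 0.
  apply: minuscule_eq0 => // a ar; apply: int_lt2; first exact: ip_coroot_lattice.
  rewrite ipBl -ipNr -[2]/(1 + 1) ltrD //; last by apply: c01; exact: root_opp.
  rewrite ip_weylV // c01 // weyl_root //; exact: weylV.
apply: (weyl_regular (c := c0)) => //; last by apply/eqP; rewrite -subr_eq0 mu0.
by move=> b br; apply: contraNneq (c0int b br) => ->; exact: rpred0.
Qed.

(** The roots in the last hypothesis are those on which the character exp (y + 2 pi i x) is 1.
    Positivity there is what permits a regular perturbation of x that w still fixes modulo the
    lattice. *)
Lemma weyl_affine_stabilizer w x y : weyl rs w -> coroot_lattice (w x - x) ->
  w y = y ->
  (forall a, a \in Phi -> 0 < ip rho a -> ip x a \is a Num.int -> ip y a = 0 ->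
     0 < ip rho (w a)) ->
  w = \1%VF.
Proof.
move=> ww wx wy wpos; pose v := (w^-1)%VF; have vw : weyl rs v := weylV ww.
have [N N0 NE] := weyl_finite_order vw.
(* Summing [rho] over the powers of w^-1 gives a vector fixed by w. *)
pose r := \sum_(k < N) iter k v rho.
have vr : v r = r.
  rewrite /r linear_sum; case: N N0 NE @r => // N _ NE r.
  rewrite big_ord_recr [RHS]big_ord_recl addrC /=; congr (_ + _).
  exact: NE.
have wr : w r = r by rewrite -{1}vr (weylVK ww).
have wkP k a : a \in Phi -> 0 < ip rho a -> ip x a \is a Num.int -> ip y a = 0 ->
    let b := iter k w a in
    [/\ b \in Phi, 0 < ip rho b, ip x b \is a Num.int & ip y b = 0].
  move=> ar ap ax ay; elim: k => //= k [br bp bx yb]; set b := iter k w a in br bp bx yb *.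
  split; [by rewrite weyl_root|exact: wpos| |by rewrite -wy ip_weyl].
  rewrite -[x](subrK (w x)) ipDl ip_weyl // rpredD // -opprB ipNl rpredN.
  by rewrite ip_coroot_lattice // weyl_root.
have rpos a : a \in Phi -> 0 < ip rho a -> ip x a \is a Num.int -> ip y a = 0 ->
    0 < ip r a.
  move=> ar ap ax ay; rewrite /r ip_suml; case: N N0 {NE r vr wr} => // N _.
  have E k : ip (iter k v rho) a = ip rho (iter k w a).
    elim: k a {ar ap ax ay} => // k IH a.
    by rewrite [in RHS]iterSr -IH /= -(ip_weyl ww) (weylVK ww).
  rewrite big_ord_recl ltr_wpDr // sumr_ge0 // => k _.
  by rewrite E; have [_ /ltW] := wkP (bump 0 k) a ar ap ax ay.
have r0 a : a \in Phi -> ip x a \is a Num.int -> ip y a = 0 -> ip r a != 0.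
  move=> ar ax ay; have [ap|ap] := root_sign ar.
    by rewrite gt_eqF // rpos //; exact: positive_rho.
  rewrite -oppr_eq0 -ipNr gt_eqF // rpos ?root_opp ?ipNr ?rpredN //.
    by have := positive_rho ap; rewrite ipNr.
  by rewrite ay oppr0.
(* A multiple of y leaves the walls of the roots with <y, a> nonzero, a multiple of r those of the
   remaining roots. *)
have [e eP] := perturb (ip x) (ip y) Phi.
have [d dP] := perturb (ip (x + e *: y)) (ip r) Phi.
apply: (affine_regular (c := x + e *: y + d *: r)) => //.
  have -> : w (x + e *: y + d *: r) = w x + e *: y + d *: r.
    by rewrite 2!linearD 2!linearZ /= wy wr.
  by rewrite !opprD addrACA subrr addr0 addrACA subrr addr0.
move=> a ar; apply/negP; rewrite ipDl ipZl => /(dP _ ar)[].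
rewrite ipDl ipZl => /(eP _ ar)[ax ay] ra.
by have := r0 a ar ax ay; rewrite ra eqxx.
Qed.

End AffineWeyl.

(** * Polar form of nonzero complex numbers *)

Section ComplexExponential.
Variable R : realType.

(* exp (b + 2 pi i a) *)
Definition cexp (a b : R) : R[i] :=
  Complex (expR b * cos (pi *+ 2 * a)) (expR b * sin (pi *+ 2 * a)).

Lemma cexpD a b c d : cexp (a + c) (b + d) = cexp a b * cexp c d.
Proof.
rewrite /cexp mulrDr expRD cosD sinD.
by apply/eqP; rewrite eq_complex /=; apply/andP; split; apply/eqP; ring.
Qed.

Lemma cexp0 : cexp 0 0 = 1.
Proof. by rewrite /cexp mulr0 expR0 cos0 sin0 mul1r mul1r. Qed.

Lemma cexpN a b : cexp (- a) (- b) = (cexp a b)^-1.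
Proof.
have E : cexp a b * cexp (- a) (- b) = 1 by rewrite -cexpD !subrr cexp0.
have c0 : cexp a b != 0.
  by apply/eqP => c0; move/eqP: E; rewrite c0 mul0r eq_sym oner_eq0.
by apply: (mulfI c0); rewrite E divff.
Qed.

Lemma cexp_int (z : int) : cexp z%:~R 0 = 1.
Proof.
have nat (k : nat) : cexp k%:R 0 = 1.
  elim: k => [|k IH]; first exact: cexp0.
  rewrite -addn1 natrD -[X in cexp _ X]addr0 cexpD IH mul1r.
  by rewrite /cexp mulr1 cos2pi sin2pi expR0 mul1r mulr0.
case: z => k; first exact: nat.
by rewrite NegzE rmorphN /= -[0]oppr0 cexpN nat invr1.
Qed.

Lemma cexp_eq1 a b : cexp a b = 1 -> a \is a Num.int /\ b = 0.
Proof.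
move=> ab1; have b0 : b = 0.
  have [re im] : expR b * cos (pi *+ 2 * a) = 1 /\ expR b * sin (pi *+ 2 * a) = 0.
    by case: ab1.
  have : expR b ^+ 2 = 1.
    rewrite -[LHS]mulr1 -(cos2Dsin2 (pi *+ 2 * a)) mulrDr -!exprMn re im.
    by rewrite cos2Dsin2 expr1n expr0n /= addr0.
  move/eqP; rewrite sqrf_eq1 => /orP[/eqP|/eqP e]; last first.
    by have := expR_gt0 b; rewrite e ltr0N1.
  by rewrite -expR0 => /expR_inj.
split=> //; set z := Num.floor a.
have : cexp (a - z%:~R) 0 = 1.
  rewrite -[0]addr0 cexpD -mulrNz cexp_int mulr1 -ab1 b0 //.
have /andP[a0 a1] : 0 <= a - z%:~R < 1.
  rewrite subr_ge0 floor_le ltrBlDl -[X in _ + X]/(1%:~R) -intrD addrC.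
  by rewrite addrC floorD1_gt.
move: a0 a1; set x := a - z%:~R => x0 x1 [].
rewrite expR0 !mul1r => c1 _.
have p0 : 0 < pi :> R := pi_gt0 R.
suff x0' : x = 0 by rewrite -[a](subrK z%:~R) -/x x0' add0r intr_int.
(* [cos] is injective only on [0, pi], so an x above one half is replaced by 1 - x. *)
have [xle|xgt] := leP x (2^-1).
  have E : pi *+ 2 * x = 0.
    apply: cos_inj; last by rewrite c1 cos0.
    - by rewrite in_itv /=; apply/andP; split; nra.
    - by rewrite in_itv /= lexx ltW.
  by move/eqP: E; rewrite mulf_eq0 mulrn_eq0 /= gt_eqF //= => /eqP.
have E : pi *+ 2 * (1 - x) = 0.
  apply: cos_inj; last 1 first.
  - by rewrite mulrBr mulr1 addrC cosD2pi cosN c1 cos0.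
  - by rewrite in_itv /=; apply/andP; split; nra.
  - by rewrite in_itv /= lexx ltW.
move/eqP: E; rewrite mulf_eq0 mulrn_eq0 /= gt_eqF //= subr_eq0 => /eqP xE.
by move: x1; rewrite -xE ltxx.
Qed.

Lemma cexp_surj (z : R[i]) : z != 0 -> exists a b, z = cexp a b.
Proof.
case: z => u v z0; pose r := Num.sqrt (u ^+ 2 + v ^+ 2).
have uv0 : 0 < u ^+ 2 + v ^+ 2.
  rewrite lt_neqAle addr_ge0 ?sqr_ge0 // andbT eq_sym paddr_eq0 ?sqr_ge0 //.
  by rewrite !sqrf_eq0; rewrite eq_complex in z0.
have r0 : 0 < r by rewrite sqrtr_gt0.
have r2 : r ^+ 2 = u ^+ 2 + v ^+ 2 by rewrite sqr_sqrtr // ltW.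
have rn0 : r != 0 by rewrite gt_eqF.
pose c := u / r.
have c2 : 1 - c ^+ 2 = (v / r) ^+ 2.
  rewrite /c !expr_div_n r2; field; by rewrite gt_eqF.
have c1 : -1 <= c <= 1.
  rewrite -ler_norml -(@expr_le1 _ 2) // real_normK ?num_real //.
  by rewrite -subr_ge0 c2 sqr_ge0.
have pi0 : pi *+ 2 != 0 :> R by rewrite mulrn_eq0 /= gt_eqF // pi_gt0.
(* [acos] yields angles in [0, pi] only; the sign e selects the half plane. *)
have main e : (e = 1 \/ e = -1) -> e * Num.sqrt (1 - c ^+ 2) = v / r ->
    Complex u v = cexp (e * acos c / (pi *+ 2)) (ln r).
  move=> e1 ev; rewrite /cexp lnK ?posrE // [pi *+ 2 * _]mulrC divfK //.
  have [cE sE] : cos (e * acos c) = c /\ sin (e * acos c) = v / r.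
    rewrite -ev; case: e1 => ->; rewrite ?mul1r ?mulN1r ?cosN ?sinN acosK ?sin_acos //.
  by rewrite cE sE /c !mulrA ![r * _]mulrC !mulfK.
have [v0|v0] := leP 0 v.
  exists (1 * acos c / (pi *+ 2)), (ln r); apply: main; first by left.
  by rewrite c2 mul1r sqrtr_sqr ger0_norm // divr_ge0 // ltW.
exists (-1 * acos c / (pi *+ 2)), (ln r); apply: main; first by right.
rewrite c2 mulN1r sqrtr_sqr ler0_norm ?opprK // pmulr_lle0 ?invr_gt0 //.
exact: ltW.
Qed.

End ComplexExponential.

(** * Characters of the weight lattice as exponentials *)

Section TorusStabilizer.
Variables (R : realType) (V : vectType R) (n : nat) (rs : rootSystem V n).
Local Notation ip := (ip rs).
Local Notation al := (simple rs).
Local Notation Phi := (Defs.roots rs).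

Lemma fweight_lattice i : fweight rs i \in weight_lattice rs.
Proof. by apply/weight_latticeP => j; rewrite fweightE; exact: natr_int. Qed.

Definition fundamental_weight i : weight rs := Weight (fweight_lattice i).

Lemma weight_ind (P : weight rs -> Prop) :
  P 0 -> (forall l m, P l -> P m -> P (l + m)) -> (forall l, P l -> P (- l)) ->
  (forall i, P (fundamental_weight i)) -> forall l, P l.
Proof.
move=> P0 PD PN Pf l; have /asboolP[z zE] := valP l.
have -> : l = \sum_i fundamental_weight i *~ z i.
  apply: val_inj; rewrite raddf_sum zE; apply: eq_bigr => i _.
  by rewrite raddfMz /= scaler_int.
apply: big_ind => // i _.
have Pn k : P (fundamental_weight i *+ k).
  by elim: k => [|k IH]; rewrite ?mulr0n // mulrS; apply: PD.
by case: (z i) => k; rewrite ?NegzE ?mulrNz; [|apply: PN]; exact: Pn.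
Qed.

Section Torus.
Variable t : weight rs -> R[i].
Hypothesis tT : torus t.

Lemma torusD l m : t (l + m) = t l * t m.
Proof. by case: tT => _ ->. Qed.

Lemma torus_neq0 l : t l != 0.
Proof. by case: tT. Qed.

Lemma torus0 : t 0 = 1.
Proof. by apply: (mulfI (torus_neq0 0)); rewrite -torusD addr0 mulr1. Qed.

Lemma torusN l : t (- l) = (t l)^-1.
Proof.
by apply: (mulfI (torus_neq0 l)); rewrite -torusD subrr torus0 divff // torus_neq0.
Qed.

(** Logarithms are chosen at the fundamental weights and extended by duality with the simple
    coroots. *)
Lemma torus_cexp : exists x y, forall l, t l = cexp (ip x (wval l)) (ip y (wval l)).
Proof.
have h i := cexp_surj (torus_neq0 (fundamental_weight i)).
pose a i := sval (cid (h i)); pose b i := sval (cid (svalP (cid (h i)))).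
have ab i : t (fundamental_weight i) = cexp (a i) (b i).
  exact: (svalP (cid (svalP (cid (h i))))).
have dual (c : 'I_n -> R) i : ip (\sum_j c j *: coroot ip (al j)) (fweight rs i) = c i.
  rewrite ip_suml (bigD1 i) //= ipZl ip_sym fweightE eqxx mulr1 big1 ?addr0 //.
  by move=> j /negPf ji; rewrite ipZl ip_sym fweightE eq_sym ji mulr0.
exists (\sum_j a j *: coroot ip (al j)), (\sum_j b j *: coroot ip (al j)).
apply: weight_ind => [|l m IHl IHm|l IH|i].
- by rewrite torus0 !(ip_sym _ _ (wval 0)) !ip0l cexp0.
- by rewrite torusD IHl IHm -cexpD -!ipDr.
- by rewrite torusN IH -cexpN -!ipNr.
- by rewrite /= !dual.
Qed.

End Torus.

(* The consequence of Steinberg's theorem (stabilizers in T are generated by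
   reflections) that the proof needs. *)
Lemma torus_stabilizer t w : torus t -> weyl rs w ->
  (forall l m : weight rs, wval m = w (wval l) -> t m = t l) ->
  (forall a : weight rs, positive_root rs (wval a) -> t a = 1 ->
     positive_root rs (w (wval a))) ->
  w = \1%VF.
Proof.
move=> tT ww tw wpos; have [x [y txy]] := torus_cexp tT.
have vw := weylV ww.
have key (l : weight rs) :
    ip (w x - x) (wval l) \is a Num.int /\ ip (w y - y) (wval l) = 0.
  have lP : (w^-1)%VF (wval l) \in weight_lattice rs.
    by apply: (weyl_weight vw); exact: (valP l).
  pose m := Weight lP.
  have := tw m l; rewrite /= (weylVK ww) => /(_ erefl) E.
  rewrite !ipBl !(ip_weylV ww) -[(w^-1)%VF (wval l)]/(wval m).
  (* The two pairings form a logarithm of t(w^-1 l) / t(l), which is 1. *)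
  apply: cexp_eq1; rewrite cexpD cexpN -!txy E divff //.
  exact: torus_neq0 tT _.
apply: (@weyl_affine_stabilizer _ _ _ rs w x y) => //.
- apply: (coroot_latticeP rs _).2 => i; rewrite ip_sym.
  exact: (key (fundamental_weight i)).1.
- apply/eqP; rewrite -subr_eq0; apply/eqP/(@ip_inj _ _ _ rs) => u.
  rewrite ip0l (fweight_coord rs u) ip_sym ip_suml big1 // => i _.
  by rewrite ipZl [ip (fweight _ _) _]ip_sym (key (fundamental_weight i)).2 mulr0.
- move=> a ar ap ax ay; pose m := Weight (root_weight ar).
  apply/positive_rho/(wpos m); first exact/positiveE.
  rewrite txy /= ay; have [z ->] := intrP ax; exact: cexp_int.
Qed.

End TorusStabilizer.

(** * The Weyl group action on characters, and inversion sets *)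

Section TorusAction.
Variables (R : realType) (V : vectType R) (n : nat) (rs : rootSystem V n).
Local Notation ip := (ip rs).
Local Notation al := (simple rs).
Local Notation S := (s_ rs).
Local Notation Phi := (Defs.roots rs).
Local Notation Sa i := (S (al i)).
Local Notation rho := (rho rs).
Local Notation sw i := (simple_weight rs i).
Implicit Types (t : weight rs -> R[i]) (l m : weight rs).

Lemma wact_eq w l m : weyl rs w -> wval m = w (wval l) -> wact w l = m.
Proof. by move=> ww E; apply: val_inj; rewrite /= E val_wact. Qed.

Lemma wactD w l m : weyl rs w -> wact w (l + m) = wact w l + wact w m.
Proof.
move=> ww; apply: wact_eq => //.
by rewrite -[wval (_ + _)]/(wval _ + wval _) !val_wact // -linearD.
Qed.

Lemma wact_comp u w l : weyl rs u -> weyl rs w ->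
  wact (u \o w)%VF l = wact u (wact w l).
Proof.
move=> uw ww; apply: wact_eq; first exact: weyl_comp.
by rewrite !val_wact // comp_lfunE.
Qed.

Lemma wact1 l : wact \1%VF l = l.
Proof. by apply: wact_eq; [exact: weyl1|rewrite id_lfunE]. Qed.

Lemma lfunV_comp (u w : 'End(V)) : weyl rs u -> weyl rs w ->
  ((u \o w)^-1 = w^-1 \o u^-1)%VF.
Proof.
move=> uw ww; apply/lfunP => v; rewrite comp_lfunE.
apply: (weyl_inj (weyl_comp uw ww)); rewrite (weylVK (weyl_comp uw ww)).
by rewrite comp_lfunE (weylVK ww) (weylVK uw).
Qed.

Lemma s_V a : a \in Phi -> ((S a)^-1)%VF = S a.
Proof.
move=> ar; apply/lfunP => v; apply: (weyl_inj (weyl_s ar)).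
by rewrite (weylVK (weyl_s ar)) s_K.
Qed.

Lemma tact_comp u w t : weyl rs u -> weyl rs w ->
  tact (u \o w)%VF t = tact u (tact w t).
Proof.
move=> uw ww; apply/funext => l; rewrite /tact lfunV_comp // wact_comp //.
  exact: weylV.
exact: weylV.
Qed.

Lemma tact1 t : tact \1%VF t = t.
Proof.
apply/funext => l; rewrite /tact; congr t; apply: wact_eq.
  by apply: weylV; exact: weyl1.
by apply: (weyl_inj (weyl1 rs)); rewrite (weylVK (weyl1 rs)) id_lfunE.
Qed.

Lemma tact_s a t l : a \in Phi -> tact (S a) t l = t (wact (S a) l).
Proof. by move=> ar; rewrite /tact s_V. Qed.

Lemma torus_tact w t : weyl rs w -> torus t -> torus (tact w t).
Proof.
move=> ww tT; split=> [l|l m]; first exact: (torus_neq0 tT).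
by rewrite /tact wactD ?torusD //; exact: weylV.
Qed.

Lemma torusMz t l z : torus t -> t l = 1 -> t (l *~ z) = 1.
Proof.
move=> tT tl; have nat k : t (l *+ k) = 1.
  by elim: k => [|k IH]; rewrite ?mulr0n ?torus0 // mulrS torusD // IH tl mulr1.
by case: z => k; rewrite ?NegzE ?mulrNz ?torusN // nat ?invr1.
Qed.

(** A weight and its reflection differ by an integer multiple of a, on which t is 1. *)
Lemma tact_refl_fixed (a : weight rs) t : torus t -> positive_root rs (wval a) ->
  t a = 1 -> tact (S (wval a)) t = t.
Proof.
move=> tT ap ta; have ar := ap.1; apply/funext => l; rewrite tact_s //.
have := ip_weight_coroot_pos ap (valP l) => /intrP[z zE].
have -> : wact (S (wval a)) l = l + a *~ (- z).
  apply: wact_eq; first exact: weyl_s.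
  rewrite s_E /refl /reflection zE scaler_int.
  by rewrite -[wval (_ + _)]/(val l + val (a *~ - z)) raddfMz /= mulrNz.
by rewrite torusD // torusMz // mulr1.
Qed.

Definition avoids_Z t (w : 'End(V)) := forall a : weight rs,
  positive_root rs (wval a) -> t a = 1 -> positive_root rs (w (wval a)).

Lemma avoids_ZP t w : weyl rs w ->
  inversions w `&` Zset t = set0 <-> avoids_Z t w.
Proof.
move=> ww; split=> [h a ap ta|h].
  have [//|neg] := root_sign (etrans (weyl_root _ ww) ap.1).
  suff : (inversions w `&` Zset t) a by rewrite h.
  by split.
apply/seteqP; split=> // a [[ap neg] [_ ta]].
have := positive_rho neg; rewrite ipNr oppr_gt0 => /lt_trans.
by move=> /(_ _ (positive_rho (h a ap ta))); rewrite ltxx.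
Qed.

(** The element v = w^-1 u fixes t, hence permutes the roots on which t is 1. If v made such a
    positive root a negative, then -v a would lie in Z(t) while w sends it to the negative root -u
    a. *)
Lemma avoids_Z_uniq t u w : torus t -> weyl rs u -> weyl rs w ->
  avoids_Z t u -> avoids_Z t w -> tact u t = tact w t -> u = w.
Proof.
move=> tT uw ww uZ wZ tuw; pose v := ((w^-1)%VF \o u)%VF.
have vw : weyl rs v by apply: weyl_comp => //; exact: weylV.
have tv : tact v t = t.
  rewrite tact_comp //; last exact: weylV.
  rewrite tuw -tact_comp //; last exact: weylV.
  rewrite (_ : (_ \o w)%VF = \1%VF) ?tact1 //.
  by apply/lfunP => x; rewrite comp_lfunE (weylK ww) id_lfunE.
have tvE l m : wval m = v (wval l) -> t m = t l.
  move=> E; rewrite -[in LHS]tv /tact; congr t; apply: wact_eq; first exact: weylV.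
  by rewrite E (weylK vw).
suff v1 : v = \1%VF.
  apply/lfunP => x; have : w (v x) = w x by rewrite v1 id_lfunE.
  by rewrite /v comp_lfunE (weylVK ww).
apply: (torus_stabilizer tT vw tvE) => a ap ta.
have vr : v (wval a) \in Phi by rewrite weyl_root // ap.1.
have [//|neg] := root_sign vr.
pose b := Weight (root_weight (root_opp vr)).
have tb : t b = 1.
  rewrite (tvE (- a)); first by rewrite torusN // ta invr1.
  by rewrite -[wval (- a)]/(- wval a) linearN.
have E : w (v (wval a)) = u (wval a) by rewrite /v comp_lfunE (weylVK ww).
have := wZ b neg tb; rewrite /= linearN /= E.
move=> /positive_rho; rewrite ipNr oppr_gt0 => /lt_trans.
by move=> /(_ _ (positive_rho (uZ a ap ta))); rewrite ltxx.
Qed.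

Lemma tact_simple_neq t w i (a : weight rs) (c : R[i]) : torus t -> weyl rs w ->
  t a = c -> tact w t (sw i) <> c -> tact w t (sw i) <> c^-1 ->
  w (wval a) != al i /\ w (wval a) != - al i.
Proof.
move=> tT ww <- ta ta'; split; apply/eqP => E.
  apply: ta; rewrite /tact; congr t; apply: wact_eq; first exact: weylV.
  by rewrite -[wval (sw i)]/(al i) -E (weylK ww).
apply: ta'; rewrite /tact -torusN //; congr t; apply: wact_eq; first exact: weylV.
by rewrite -[wval (sw i)]/(al i) -[al i]opprK -E linearN /= (weylK ww).
Qed.

Lemma neg_simple_step w i a : weyl rs w -> a \in Phi ->
  w a != al i -> w a != - al i ->
  negative_root rs ((Sa i \o w)%VF a) <-> negative_root rs (w a).
Proof.
move=> ww ar ai ai'; have wr : w a \in Phi by rewrite weyl_root.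
have sr : (Sa i \o w)%VF a \in Phi.
  by rewrite weyl_root //; apply: weyl_comp => //; exact: weyl_simple.
rewrite !negativeE // comp_lfunE s_E.
have pos b : b \in Phi -> b != al i -> b != - al i ->
    (0 < ip rho (refl rs (al i) b)) = (0 < ip rho b).
  move=> br bi bi'; apply/idP/idP => [h|]; last by move/refl_simple_pos; apply.
  have := refl_simple_pos (i := i) (roots_reflection (simple_roots rs i) br) h.
  rewrite -[reflection _ _ _]/(refl rs (al i) b) reflK ?simple_roots //; apply.
  apply: contraNneq bi' => E; apply/eqP.
  rewrite -[b](reflK (simple_roots rs i)) E refl_self //; exact: simple_roots.
have := pos (- w a); rewrite root_opp // eqr_oppLR ai' eqr_opp ai linearN.
by rewrite !ipNr !oppr_gt0 => ->.
Qed.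

(** The reflection s_i changes the sign of no root except alpha_i and its negative. *)
Lemma inversions_step w i (Q : set (weight rs)) : weyl rs w ->
  (forall a, Q a -> w (wval a) != al i /\ w (wval a) != - al i) ->
  inversions (Sa i \o w)%VF `&` Q = inversions w `&` Q.
Proof.
move=> ww wQ; apply/seteqP; split=> a [[ap neg] Qa]; split=> //; split=> //;
  by have [ai ai'] := wQ a Qa; apply/(neg_simple_step ww ap.1 ai ai').
Qed.

Lemma avoids_Z_step t w i : torus t -> weyl rs w -> tact w t (sw i) != 1 ->
  avoids_Z t w -> avoids_Z t (Sa i \o w)%VF.
Proof.
move=> tT ww /eqP ti wZ; apply/avoids_ZP.
  by apply: weyl_comp => //; exact: weyl_simple.
rewrite inversions_step //; first exact/avoids_ZP.
move=> a [_ ta]; apply: (tact_simple_neq tT ww ta) => //.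
by rewrite invr1.
Qed.

Lemma Pset_step q t w i : torus t -> weyl rs w -> tact w t (sw i) <> q ^+ 2 ->
  tact w t (sw i) <> q ^- 2 ->
  inversions (Sa i \o w)%VF `&` Pset q t = inversions w `&` Pset q t.
Proof.
move=> tT ww ti ti'; apply: inversions_step => // a [_ [ta|ta]];
  by apply: (tact_simple_neq tT ww ta); rewrite ?invrK.
Qed.

End TorusAction.

(** * Separating characters *)

Section Separation.
Variables (R : realType) (V : vectType R) (n : nat) (rs : rootSystem V n).
Implicit Types (t : weight rs -> R[i]).

Definition cev (f : seq (R[i] * weight rs)) t : R[i] := \sum_(p <- f) p.1 * t p.2.

Lemma cev_separate (I : eqType) (r : seq I) (ts : I -> weight rs -> R[i]) t :
  torus t -> (forall i, torus (ts i)) ->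
  exists f, cev f t = 1 /\
    forall i, i \in r -> cev f (ts i) = if `[< ts i = t >] then 1 else 0.
Proof.
move=> tT tsT; elim: r => [|i r [f [ft fr]]].
  by exists [:: (1, 0)]; split=> //; rewrite /cev big_seq1 /= mul1r torus0.
have [it|it] := pselect (ts i = t).
  exists f; split=> // j; rewrite in_cons => /orP[/eqP->|/fr //].
  by case: asboolP => // _; rewrite it.
have [l tl] : exists l, ts i l != t l.
  apply: contrapT => /forallNP h; apply: it; apply/funext => l.
  by have /negP := h l; rewrite negbK => /eqP.
have dl : t l - ts i l != 0 by rewrite subr_eq0 eq_sym.
(* In C[X] this is f times (X^l - ts_i(l)) / (t(l) - ts_i(l)), a Lagrange factor with value 1 at t
   and 0 at ts_i. *)
pose g := [seq ((t l - ts i l)^-1 * p.1, p.2 + l) | p <- f] ++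
  [seq (- ts i l * (t l - ts i l)^-1 * p.1, p.2) | p <- f].
have gE t' : torus t' -> cev g t' = (t' l - ts i l) / (t l - ts i l) * cev f t'.
  move=> t'T; rewrite /cev big_cat !big_map /= mulr_sumr -big_split /=.
  by apply: eq_bigr => p _; rewrite torusD //; ring.
exists g; split=> [|j]; first by rewrite gE // ft divff // mulr1.
rewrite in_cons gE // => /orP[/eqP->|/fr ->].
  by rewrite subrr !mul0r; case: asboolP.
case: asboolP => [->|_]; last by rewrite mulr0.
by rewrite divff // mulr1.
Qed.

End Separation.

(** * Submodules given by predicates *)

Section Closure.
Variables (K : comNzRingType) (A : algType K) (M : lmodType A).

(** Bundling a predicate with its closure proofs lets one instance declaration serve every predicate
    passed to [irreducible_ind]. *)
Record submodule_pred := SubmodulePred {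
  submodule_mem : M -> Prop;
  submodule0 : submodule_mem 0;
  submoduleDZ : forall h x y, submodule_mem x -> submodule_mem y ->
    submodule_mem (h *: x + y)
}.

Definition submodule_bool (P : submodule_pred) : {pred M} :=
  fun x => `[< submodule_mem P x >].

Fact submodule_bool_closed P : submod_closed (submodule_bool P).
Proof.
split=> [|h x y /asboolP Px /asboolP Py]; apply/asboolP; first exact: submodule0.
exact: submoduleDZ.
Qed.

HB.instance Definition _ P :=
  GRing.isSubmodClosed.Build A M (submodule_bool P) (submodule_bool_closed P).

Lemma irreducible_ind (P : M -> Prop) : irreducible M -> P 0 ->
  (forall h x y, P x -> P y -> P (h *: x + y)) ->
  (exists2 x, x != 0 & P x) -> forall x, P x.
Proof.
move=> [_ Mirr] P0 PDZ [x x0 Px] y.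
pose N := SubmodulePred P0 PDZ.
have [N0|NT] := Mirr (submodule_bool N).
  by case/eqP: x0; apply: N0; apply/asboolP.
by have /asboolP := NT y.
Qed.

End Closure.

(** * Modules over the affine Hecke algebra and their intertwiners *)

Section HeckeModule.
Variables (R : realType) (V : vectType R) (n : nat) (rs : rootSystem V n).
Variable q : R[i].
Variable M : lmodType (hecke rs q).
Local Notation ip := (ip rs).
Local Notation al := (simple rs).
Local Notation S := (s_ rs).
Local Notation Sa i := (S (al i)).
Local Notation rho := (rho rs).
Local Notation sw i := (simple_weight rs i).
Local Notation T i := (hT rs q i).
Local Notation X := (@hX R V n rs q).
Local Notation word := (word rs).
Local Notation reduced := (reduced rs).
Local Notation wt := (weight_space X (M := M)).
Implicit Types (t : weight rs -> R[i]) (x y m : M) (c : R[i]).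

Definition sc c m : M := (c%:A : hecke rs q) *: m.

Lemma scDr c x y : sc c (x + y) = sc c x + sc c y.
Proof. exact: scalerDr. Qed.

Lemma scDl c d x : sc (c + d) x = sc c x + sc d x.
Proof. by rewrite /sc scalerDl scalerDl. Qed.

Lemma scA c d x : sc c (sc d x) = sc (c * d) x.
Proof. by rewrite /sc scalerA mulr_algl scalerA. Qed.

Lemma sc1 x : sc 1 x = x.
Proof. by rewrite /sc scale1r scale1r. Qed.

Lemma sc0 x : sc 0 x = 0.
Proof. by rewrite /sc scale0r scale0r. Qed.

Lemma scr0 c : sc c 0 = 0.
Proof. exact: scaler0. Qed.

Lemma scN c x : sc (- c) x = - sc c x.
Proof. by rewrite /sc scaleNr scaleNr. Qed.

Lemma sc_comm c (h : hecke rs q) x : h *: sc c x = sc c (h *: x).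
Proof. by rewrite /sc !scalerA mulr_algl mulr_algr. Qed.

Lemma scZ c (h : hecke rs q) x : (c *: h) *: x = sc c (h *: x).
Proof. by rewrite /sc scalerA mulr_algl. Qed.

Lemma sc_eq0 c x : sc c x = 0 -> c = 0 \/ x = 0.
Proof.
have [->|c0] := eqVneq c 0; [by left|move=> E; right].
by rewrite -[x]sc1 -(mulVf c0) -scA E scr0.
Qed.

Lemma sc_sumr (I : Type) (r : seq I) (P : pred I) (F : I -> M) c :
  sc c (\sum_(i <- r | P i) F i) = \sum_(i <- r | P i) sc c (F i).
Proof. exact: scaler_sumr. Qed.

Lemma sc_suml (I : Type) (r : seq I) (P : pred I) (F : I -> R[i]) x :
  sc (\sum_(i <- r | P i) F i) x = \sum_(i <- r | P i) sc (F i) x.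
Proof. by rewrite /sc scaler_suml scaler_suml. Qed.

Lemma hecke_closed (P : M -> Prop) :
  (forall x y, P x -> P y -> P (x + y)) -> (forall c x, P x -> P (sc c x)) ->
  (forall i x, P x -> P (T i *: x)) -> (forall l x, P x -> P (X l *: x)) ->
  forall h x, P x -> P (h *: x).
Proof.
move=> PD PZ PT PX h; have [y ->] := hpi_surj h.
elim: y => [c|i|l|y IHy z IHz|y IHy z IHz] x Px.
- by rewrite hpi_const; exact: PZ.
- exact: PT.
- exact: PX.
- rewrite -haddE -[hadd _ _]/(hpi q y + hpi q z) scalerDl.
  by apply: PD; [exact: IHy|exact: IHz].
- rewrite -hmulE -[hmul _ _]/(hpi q y * hpi q z) -scalerA.
  by apply: IHy; exact: IHz.
Qed.

(** * Linear combinations of a family indexed by words *)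

Definition lspan (G : seq 'I_n -> Prop) (g : seq 'I_n -> M) x :=
  exists2 r : seq (R[i] * seq 'I_n), (forall p, p \in r -> G p.2) &
    x = \sum_(p <- r) sc p.1 (g p.2).

Lemma lspan0 G g : lspan G g 0.
Proof. by exists [::] => //; rewrite big_nil. Qed.

Lemma lspanD G g x y : lspan G g x -> lspan G g y -> lspan G g (x + y).
Proof.
move=> [r rG ->] [r' r'G ->]; exists (r ++ r'); last by rewrite big_cat.
by move=> p; rewrite mem_cat => /orP[/rG|/r'G].
Qed.

Lemma lspanZ G g c x : lspan G g x -> lspan G g (sc c x).
Proof.
move=> [r rG ->]; exists [seq (c * p.1, p.2) | p <- r].
  by move=> _ /mapP[p /rG pG ->].
by rewrite big_map sc_sumr; apply: eq_bigr => p _; rewrite scA.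
Qed.

Lemma lspanN G g x : lspan G g x -> lspan G g (- x).
Proof. by rewrite -[x in - x]sc1 -scN; exact: lspanZ. Qed.

Lemma lspan_gen (G : seq 'I_n -> Prop) g s : G s -> lspan G g (g s).
Proof.
move=> Gs; exists [:: (1, s)] => [p|]; first by rewrite inE => /eqP->.
by rewrite big_seq1 sc1.
Qed.

Lemma lspan_bind G g G' g' (h : hecke rs q) x :
  (forall s, G s -> lspan G' g' (h *: g s)) -> lspan G g x ->
  lspan G' g' (h *: x).
Proof.
move=> H [r + ->]; elim: r => [_|p r IH rG].
  by rewrite big_nil scaler0; exact: lspan0.
rewrite big_cons scalerDr sc_comm; apply: lspanD.
  by apply/lspanZ/H/rG; rewrite mem_head.
by apply: IH => p' p'r; apply: rG; rewrite in_cons p'r orbT.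
Qed.

Lemma lspan_sub G g G' g' x :
  (forall s, G s -> lspan G' g' (g s)) -> lspan G g x -> lspan G' g' x.
Proof.
move=> H xs; rewrite -[x]scale1r; apply: lspan_bind xs => s Gs.
by rewrite scale1r; exact: H.
Qed.

Definition Tword (s : seq 'I_n) : hecke rs q := \prod_(i <- s) T i.

Lemma Tword_cons i s m : Tword (i :: s) *: m = T i *: (Tword s *: m).
Proof. by rewrite /Tword big_cons scalerA. Qed.

Lemma T_T i m : T i *: (T i *: m) = sc (q - q^-1) (T i *: m) + m.
Proof. by rewrite scalerA -expr2 hT_quadratic scalerDl scale1r scZ. Qed.

Local Notation Tspan k m :=
  (lspan (fun s => (size s < k)%N) (fun s => Tword s *: m)).

Lemma Tspan_gen s k m : (size s < k)%N -> Tspan k m (Tword s *: m).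
Proof.
by move=> sk; exact: (@lspan_gen (fun s => (size s < k)%N) (fun s => Tword s *: m)).
Qed.

(** The essential case is [i :: s] with s reduced. Then i is a descent of s, Matsumoto's theorem
    lets the T-word of s begin with T_i, and the quadratic relation shortens T_i T_i. *)
Lemma Tword_nonreduced s m : ~ reduced s -> Tspan (size s) m (Tword s *: m).
Proof.
elim: s => [|i s IH] nr; first by case: nr => s' _.
have [sr|sr] := pselect (reduced s); last first.
  rewrite Tword_cons; apply: lspan_bind (IH sr) => s' ss'.
  by rewrite -Tword_cons; exact: Tspan_gen.
have neg : ip rho (((word s)^-1)%VF (al i)) < 0.
  have [pos|//] := simple_sgn i (weylV (weyl_word rs s)).
  by case: nr; exact: reduced_cons.
have [s' [s'r E]] := descent sr neg.
have sE : Tword s = Tword (i :: s').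
  apply: (matsumoto (rs := rs)) => // j k o jk jko.
  by rewrite -!prod_alt; exact: hT_braid.
rewrite Tword_cons sE Tword_cons T_T -Tword_cons.
have sz : size s = (size s').+1 by rewrite -(reduced_eq_size s'r sr E).
by apply: lspanD; [apply: lspanZ|]; apply: Tspan_gen; rewrite /= sz.
Qed.

(** * Weight vectors *)

Lemma wt_sc t c m : wt t m -> wt t (sc c m).
Proof. by move=> mt l; rewrite sc_comm mt -/(sc _ _) -/(sc _ _) !scA mulrC. Qed.

Lemma wt0 t : wt t 0.
Proof. by move=> l; rewrite !scaler0. Qed.

Definition cel (f : seq (R[i] * weight rs)) : hecke rs q :=
  \sum_(p <- f) p.1 *: X p.2.

Lemma cel_wt f t m : wt t m -> cel f *: m = sc (cev f t) m.
Proof.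
move=> mt; rewrite /cel /cev scaler_suml sc_suml; apply: eq_bigr => p _.
by rewrite scZ mt -/(sc _ _) scA.
Qed.

(** A combination of the X^l with value 1 at t and 0 at the other weights is applied to both
    sides. *)
Lemma wt_project (I : eqType) (r : seq I) (ts : I -> weight rs -> R[i])
    (F : I -> M) t m : torus t -> (forall i, torus (ts i)) ->
  wt t m -> (forall i, wt (ts i) (F i)) -> m = \sum_(i <- r) F i ->
  m = \sum_(i <- r | `[< ts i = t >]) F i.
Proof.
move=> tT tsT mt Ft mE; have [f [ft fr]] := cev_separate r tT tsT.
rewrite -[LHS]sc1 -ft -(cel_wt _ mt) mE scaler_sumr [RHS]big_mkcond /=.
rewrite big_seq [RHS]big_seq; apply: eq_bigr => i ir.
by rewrite (cel_wt _ (Ft i)) fr //; case: asbool; rewrite ?sc1 ?sc0.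
Qed.

Lemma mmap_wt (p : group_algebra rs) t m : wt t m ->
  mmap (in_alg (hecke rs q)) X p *: m = sc (mmap id t p) m.
Proof.
move=> mt; rewrite /mmap scaler_suml sc_suml; apply: eq_bigr => l _.
by rewrite -scalerA mt -/(sc _ _) -/(sc _ _) scA.
Qed.

Lemma demazure_eval t i l f : torus t -> demazure i l f ->
  mmap id t f * (1 - (t (sw i))^-1) = t l - t (wact (Sa i) l).
Proof.
move=> tT /(congr1 (mmap id t)).
have mmapB p1 p2 : mmap id t (p1 - p2) = mmap id t p1 - mmap id t p2.
  exact: (raddfB (mmap (idfun : {additive R[i] -> R[i]}) t)).
have mmapX k (p : group_algebra rs) : mmap id t (mulX k p) = mmap id t p * t k.
  rewrite /mulX (raddf_sum (mmap (idfun : {additive R[i] -> R[i]}) t)) /=.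
  rewrite /mmap mulr_suml; apply: eq_bigr => l' _.
  by rewrite -/(mmap _ _ _) (mmapU (f := idfun)) torusD // mulrA.
rewrite !mmapB mmapX !(mmapU (f := idfun)) !mul1r torusN // => <-.
by rewrite mulrBr mulr1.
Qed.

Definition tau_coef (a : R[i]) : R[i] := (q - q^-1) / (1 - a^-1).

(** The number a is meant to be the eigenvalue of X^alpha_i on m. With a scalar in place of a
    rational function of X^alpha_i, the map is defined on all of M. *)
Definition tau i (a : R[i]) m : M := T i *: m - sc (tau_coef a) m.

Lemma tau0 i a : tau i a 0 = 0.
Proof. by rewrite /tau scaler0 scr0 subr0. Qed.

Lemma X_T_wt t i l m f : wt t m -> demazure i l f ->
  X l *: (T i *: m) = sc (t (wact (Sa i) l)) (T i *: m)
    + sc ((q - q^-1) * mmap id t f) m.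
Proof.
move=> mt df; rewrite scalerA (hX_hT q df) scalerDl -scalerA mt.
by rewrite -/(sc _ _) sc_comm scZ (mmap_wt _ mt) scA.
Qed.

(** On m the extra term of the Bernstein relation is the scalar [tau_coef] times t(l) - t(s_i l);
    subtracting [tau_coef] times m from T_i m absorbs it. *)
Lemma wt_tau t i m : torus t -> wt t m -> t (sw i) != 1 ->
  wt (tact (Sa i) t) (tau i (t (sw i)) m).
Proof.
move=> tT mt t1 l; have [f df] := demazure_exists i l.
rewrite tact_s ?simple_roots // -/(sc _ _) /tau scalerBr (X_T_wt mt df).
rewrite sc_comm mt -/(sc _ _) scA scDr -scN -!addrA; congr (_ + _).
have a0 : t (sw i) != 0 by exact: torus_neq0.
have a1 : 1 - (t (sw i))^-1 != 0.
  by rewrite subr_eq0 eq_sym invr_eq1.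
rewrite -scN scA -scDl; congr sc.
have cE : tau_coef (t (sw i)) * (1 - (t (sw i))^-1) = q - q^-1 by rewrite divfK.
rewrite -cE -mulrA [_ * mmap _ _ _]mulrC (demazure_eval tT df).
ring.
Qed.

Lemma tau_tau i a m : a != 0 -> a != 1 ->
  tau i a^-1 (tau i a m) = sc (1 + tau_coef a * tau_coef a^-1) m.
Proof.
move=> a0 a1; have b1 : 1 - a^-1 != 0 by rewrite subr_eq0 eq_sym invr_eq1.
have b1' : 1 - a != 0 by rewrite subr_eq0 eq_sym.
(* This sum cancels the linear term of the quadratic relation. *)
have cE : tau_coef a + tau_coef a^-1 = q - q^-1.
  rewrite /tau_coef invrK; move: (q - q^-1) => d; field.
  by rewrite b1' a0 subr_eq0 a1.
rewrite /tau; set c := tau_coef a in cE *; set d := tau_coef a^-1 in cE *.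
rewrite scalerBr T_T -cE sc_comm scDl; set u := T i *: m.
have -> : sc d (u - sc c m) = sc d u - sc (c * d) m.
  by rewrite scDr -scN scA mulrN scN mulrC.
rewrite -[sc c u + _ + m]addrA [sc c u + _]addrC addrK opprB.
by rewrite [sc (c * d) m - _]addrC addrACA subrr add0r scDl sc1.
Qed.

Hypotheses (q_neq0 : q != 0) (q2_neq1 : q ^+ 2 != 1).

Lemma qB_neq0 : q - q^-1 != 0.
Proof.
apply: contraNneq q2_neq1 => /eqP; rewrite subr_eq0 => /eqP qE.
by rewrite expr2 {1}qE mulVf.
Qed.

Lemma tau_coef_eq0 a : a != 0 -> a != 1 ->
  (1 + tau_coef a * tau_coef a^-1 == 0) = (a == q ^+ 2) || (a == q ^- 2).
Proof.
move=> a0 a1; have b1 : a - 1 != 0 by rewrite subr_eq0.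
have b1' : 1 - a != 0 by rewrite subr_eq0 eq_sym.
have -> : 1 + tau_coef a * tau_coef a^-1 =
    (a - q ^+ 2) * (a - q ^- 2) / (a - 1) ^+ 2.
  rewrite /tau_coef; field.
  by rewrite q_neq0 b1 b1' a0.
by rewrite mulf_eq0 invr_eq0 expf_eq0 /= (negPf b1) orbF mulf_eq0 !subr_eq0.
Qed.

Definition gen_wt_eq := forall t, torus t ->
  gen_weight_space X (M := M) t = wt t.

(** If t(X^alpha_i) = 1, then s_i fixes t and (X^l - t(l))^2 kills T_i m for all l, so by
    calibration T_i m has weight t. At l = omega_i the divided difference is X^omega_i itself, which
    leaves the nonzero term (q - q^-1) t(omega_i) m, a contradiction. *)
Lemma weight_simple_neq1 t i m : gen_wt_eq -> torus t -> wt t m -> m != 0 ->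
  t (sw i) != 1.
Proof.
move=> cal tT mt; apply: contraNneq => t1; pose w := fundamental_weight rs i.
have ar := simple_roots rs i.
have st : tact (Sa i) t = t.
  exact: (tact_refl_fixed (a := sw i) tT (positive_simple rs i) t1).
have sE (l : weight rs) : t (wact (Sa i) l) = t l by rewrite -tact_s // st.
have swE : wact (Sa i) w = w - sw i.
  apply: wact_eq; first exact: weyl_simple.
  rewrite s_E /refl /reflection -[wval (w - _)]/(fweight rs i - al i) /=.
  by rewrite fweightE eqxx scale1r.
have dw : demazure i w << w >> by rewrite /demazure mulXU swE.
have Xw := X_T_wt mt dw.
have mw : mmap id t << w >> = t w by rewrite (mmapU (f := idfun)) mul1r.
suff : wt t (T i *: m).
  move=> /(_ w); rewrite Xw sE mw -/(sc _ _) => /eqP.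
  rewrite -subr_eq0 addrAC subrr add0r => /eqP/sc_eq0[/eqP|->//].
  by rewrite mulf_eq0 (negPf qB_neq0) (negPf (torus_neq0 tT w)).
rewrite -cal // => l; exists 2 => //.
have [f df] := demazure_exists i l.
rewrite expr2 -scalerA [_ *: (T i *: m)]scalerBl (X_T_wt mt df) sE -/(sc _ _).
rewrite addrAC subrr add0r.
by rewrite sc_comm scalerBl mt subrr scr0.
Qed.

End HeckeModule.

Lemma comp_weyl_inj (R : realType) (V : vectType R) (n : nat)
    (rs : rootSystem V n) (u v w : 'End(V)) :
  weyl rs u -> (v \o u = w \o u)%VF -> v = w.
Proof.
move=> uw E; apply/lfunP => x; rewrite -[x](weylVK uw).
by have := congr1 (fun f : 'End(V) => f ((u^-1)%VF x)) E; rewrite !comp_lfunE.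
Qed.

(** * Weight spaces of an irreducible calibrated module *)

Section CalibratedModule.
Variables (R : realType) (V : vectType R) (n : nat) (rs : rootSystem V n).
Variable q : R[i].
Variable M : lmodType (hecke rs q).
Local Notation ip := (ip rs).
Local Notation al := (simple rs).
Local Notation S := (s_ rs).
Local Notation Phi := (Defs.roots rs).
Local Notation Sa i := (S (al i)).
Local Notation rho := (rho rs).
Local Notation sw i := (simple_weight rs i).
Local Notation T i := (hT rs q i).
Local Notation X := (@hX R V n rs q).
Local Notation word := (word rs).
Local Notation reduced := (reduced rs).
Local Notation wt := (weight_space X (M := M)).
Local Notation Tspan k m :=
  (lspan (fun s' => (size s' < k)%N) (fun s' => Tword rs q s' *: m)).

Hypotheses (q_neq0 : q != 0) (q2_neq1 : q ^+ 2 != 1).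
Hypothesis M_cal : gen_wt_eq M.
Hypothesis M_irr : irreducible M.
Variable t : weight rs -> R[i].
Hypothesis tT : torus t.
Implicit Types (x y m : M) (u w : 'End(V)).

Local Notation acoef w i := (tact w t (sw i)).

(* For m of weight ut, the coefficient used at each step is the value of X^alpha_i
   on the vector that tau_i is applied to. *)
Fixpoint tau_word u (s : seq 'I_n) m : M :=
  if s is i :: s' then tau i (acoef (word s' \o u)%VF i) (tau_word u s' m) else m.

Lemma acoef_neq1 u i m : weyl rs u -> wt (tact u t) m -> m != 0 -> acoef u i != 1.
Proof. by move=> uw; apply: weight_simple_neq1 => //; exact: torus_tact. Qed.

Lemma wt_tau_u u i m : weyl rs u -> wt (tact u t) m -> acoef u i != 1 ->
  wt (tact (Sa i \o u)%VF t) (tau i (acoef u i) m).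
Proof.
move=> uw mt a1; rewrite tact_comp //; last exact: weyl_simple.
by apply: wt_tau => //; exact: torus_tact.
Qed.

Lemma wt_tau_word u s m : weyl rs u -> wt (tact u t) m ->
  wt (tact (word s \o u)%VF t) (tau_word u s m).
Proof.
move=> uw mt; elim: s => [|i s IH] /=; first by rewrite comp_lfun1l.
(* The zero vector stays zero and satisfies every weight condition; a nonzero one guarantees that
   the next coefficient has a nonzero denominator. *)
have [->|y0] := eqVneq (tau_word u s m) 0; first by rewrite tau0; exact: wt0.
have ww : weyl rs (word s \o u)%VF by apply: weyl_comp => //; exact: weyl_word.
rewrite -comp_lfunA; apply: wt_tau_u => //.
exact: acoef_neq1 ww IH y0.
Qed.

Lemma tau_word_head u i s m : tau_word u (i :: s) m != 0 -> tau_word u s m != 0.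
Proof. by apply: contraNneq => /= ->; rewrite tau0. Qed.

(** Each nonzero intermediate vector has a weight whose value at the next simple root is not 1, so
    no step crosses a root of Z(t). *)
Lemma avoids_Z_tau_word u s m : weyl rs u -> wt (tact u t) m -> avoids_Z t u ->
  tau_word u s m != 0 -> avoids_Z t (word s \o u)%VF.
Proof.
move=> uw mt uZ; elim: s => [|i s IH]; first by rewrite comp_lfun1l.
move=> /tau_word_head y0; rewrite -[word _]/(Sa i \o word s)%VF -comp_lfunA.
have ww : weyl rs (word s \o u)%VF by apply: weyl_comp => //; exact: weyl_word.
apply: avoids_Z_step => //; last exact: IH.
exact: acoef_neq1 ww (wt_tau_word s uw mt) y0.
Qed.

Lemma TspanT i k m x : Tspan k m x -> Tspan k.+1 m (T i *: x).
Proof. by apply: lspan_bind => s sk; rewrite -Tword_cons; exact: Tspan_gen. Qed.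

Lemma TspanW j k m x : (j <= k)%N -> Tspan j m x -> Tspan k m x.
Proof.
by move=> jk; apply: lspan_sub => s sj; apply: Tspan_gen; exact: leq_trans sj jk.
Qed.

Lemma tau_word_Tword u s m : Tspan (size s) m (tau_word u s m - Tword rs q s *: m).
Proof.
elim: s => [|i s IH] /=.
  by rewrite /Tword big_nil scale1r subrr; exact: lspan0.
rewrite Tword_cons /tau addrAC -scalerBr; apply: lspanD; first exact: TspanT.
apply: lspanN; apply: lspanZ.
rewrite -[tau_word u s m](subrK (Tword rs q s *: m)); apply: lspanD.
  exact: TspanW (leqnSn _) IH.
exact: Tspan_gen.
Qed.

(** Induction on the length: a reduced T-word is its tau-word plus shorter T-words, and any other
    one is a combination of shorter T-words. *)
Lemma Tword_reduced_span u s m :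
  lspan reduced (fun s' => tau_word u s' m) (Tword rs q s *: m).
Proof.
have [k] := ubnP (size s); elim: k s => // k IH s; rewrite ltnS => sk.
have sub x : Tspan (size s) m x -> lspan reduced (fun s' => tau_word u s' m) x.
  by apply: lspan_sub => s' ss'; apply: IH; exact: leq_trans ss' sk.
have [sr|sr] := pselect (reduced s); last exact/sub/Tword_nonreduced.
rewrite -[_ *: m](subKr (tau_word u s m)); apply: lspanD.
  exact: (@lspan_gen _ _ _ _ _ _ reduced (fun s' => tau_word u s' m)).
by apply: lspanN; apply: sub; exact: tau_word_Tword.
Qed.

(** T_i sends the vector of s to that of [i :: s] plus a multiple of itself, so all tau-words
    together span a submodule, which is M by irreducibility. Passing through T-words then leaves
    only the reduced ones. *)
Lemma tau_word_span u m : weyl rs u -> wt (tact u t) m -> m != 0 ->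
  forall x, lspan reduced (fun s => tau_word u s m) x.
Proof.
move=> uw mt m0.
pose g s := tau_word u s m; pose TT (s : seq 'I_n) := True.
have gen s : lspan TT g (g s) by exact: (@lspan_gen _ _ _ _ _ _ TT g).
have all x : lspan TT g x.
  have closed : forall h x, lspan TT g x -> lspan TT g (h *: x).
    apply: hecke_closed => [a b|c a|i a|l a]; [exact: lspanD|exact: lspanZ| |].
      apply: lspan_bind => s _.
      rewrite -[T i *: g s](subrK (sc (tau_coef q (acoef (word s \o u)%VF i)) (g s))).
      by apply: lspanD; [exact: (gen (i :: s))|exact/lspanZ/gen].
    apply: lspan_bind => s _; rewrite (wt_tau_word s uw mt) -/(sc _ _).
    by apply: lspanZ; exact: gen.
  apply: irreducible_ind x => //; first exact: lspan0.
    by move=> h a b aP bP; apply: lspanD => //; exact: closed.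
  by exists m => //; exact: (gen [::]).
move=> x; apply: lspan_sub (all x) => s _.
rewrite -[g s](subrK (Tword rs q s *: m)); apply: lspanD.
  by apply: (lspan_sub _ (tau_word_Tword u s m)) => s' _; exact: Tword_reduced_span.
exact: Tword_reduced_span.
Qed.

(** Projection to the weight w t keeps the terms of that weight. The nonzero ones avoid Z(t), and
    [avoids_Z_uniq] turns equality of weights into equality in the Weyl group. *)
Lemma weight_span u w m x : weyl rs u -> weyl rs w -> avoids_Z t u ->
  avoids_Z t w -> wt (tact u t) m -> m != 0 -> wt (tact w t) x ->
  lspan (fun s => [/\ reduced s, (word s \o u)%VF = w & tau_word u s m != 0])
    (fun s => tau_word u s m) x.
Proof.
move=> uw ww uZ wZ mt m0 xt.
have [r rr xE] := tau_word_span uw mt m0 x.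
have cw s : weyl rs (word s \o u)%VF by apply: weyl_comp => //; exact: weyl_word.
pose ts (p : R[i] * seq 'I_n) := tact (word p.2 \o u)%VF t.
have := wt_project (r := r) (ts := ts) (F := fun p => sc p.1 (tau_word u p.2 m))
  (torus_tact ww tT) (fun p => torus_tact (cw p.2) tT) xt
  (fun p => wt_sc p.1 (wt_tau_word p.2 uw mt)) xE.
move=> {}xE.
pose Q (p : R[i] * seq 'I_n) := `[< ts p = tact w t >] && (tau_word u p.2 m != 0).
exists [seq p <- r | Q p].
  move=> p; rewrite mem_filter => /andP[/andP[/asboolP tp y0] pr]; split=> //.
    exact: rr.
  apply: (avoids_Z_uniq tT (cw p.2) ww _ wZ tp).
  exact: avoids_Z_tau_word uw mt uZ y0.
rewrite xE big_filter big_mkcond [RHS]big_mkcond; apply: eq_bigr => p _.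
by rewrite /Q; case: asbool => //=; case: eqVneq => //= ->; rewrite scr0.
Qed.

Lemma weight_line u m x : weyl rs u -> avoids_Z t u -> wt (tact u t) m -> m != 0 ->
  wt (tact u t) x -> exists c, x = sc c m.
Proof.
move=> uw uZ mt m0 xt; have [r rP ->] := weight_span uw uw uZ uZ mt m0 xt.
exists (\sum_(p <- r) p.1); rewrite sc_suml big_seq [RHS]big_seq.
apply: eq_bigr => p /rP[pr pE _].
suff -> : p.2 = [::] by [].
have w1 : word [::] = word p.2 by apply: (comp_weyl_inj uw); rewrite pE comp_lfun1l.
by have := pr _ w1; case: (p.2).
Qed.

Lemma reduced_simple s i : reduced s -> word s = Sa i -> s = [:: i].
Proof.
move=> sr sE; have E1 : word [:: i] = word s by rewrite sE /= comp_lfun1r.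
have Nal : al i != - al i.
  rewrite -subr_eq0 opprK -mulr2n -scaler_nat scaler_eq0 pnatr_eq0 /=.
  by rewrite (root_neq0 (simple_roots rs i)).
case: s sr sE E1 (sr _ E1) => [|j [|//]] sr sE E1 _.
  by case/eqP: Nal; rewrite -simple_self -sE id_lfunE.
congr [:: _]; have [//|ji] := eqVneq j i.
have aij : al j != al i.
  apply: contraNneq ji => E.
  have := @simple_free _ _ _ rs (fun k => (k == j)%:R) (fun k => (k == i)%:R).
  have sumE k : \sum_j (j == k)%:R *: al j = al k.
    rewrite (bigD1 k) //= eqxx scale1r big1 ?addr0 // => l /negPf ->.
    by rewrite scale0r.
  rewrite !sumE => /(_ E j); rewrite eqxx; case: eqP => // _ /eqP.
  by rewrite oner_eq0.
have := refl_simple_pos (simple_roots rs j) (ip_rho_simple rs j) aij.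
rewrite -s_E -sE /= comp_lfun1r simple_self ipNr oppr_gt0.
by move/lt_trans/(_ (ip_rho_simple rs j)); rewrite ltxx.
Qed.

Lemma acoef_neq0 u i : acoef u i != 0.
Proof. exact: (torus_neq0 tT). Qed.

Lemma acoef_step u i : weyl rs u -> acoef (Sa i \o u)%VF i = (acoef u i)^-1.
Proof.
move=> uw; rewrite tact_comp //; last exact: weyl_simple.
rewrite tact_s ?simple_roots // -torusN; last exact: torus_tact.
congr (tact u t _); apply: wact_eq; first exact: weyl_simple.
by rewrite -[wval (sw i)]/(al i) simple_self.
Qed.

Lemma tau_twice u i m : weyl rs u -> wt (tact u t) m -> m != 0 ->
  tau i (acoef (Sa i \o u)%VF i) (tau i (acoef u i) m) =
  sc (1 + tau_coef q (acoef u i) * tau_coef q (acoef u i)^-1) m.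
Proof.
move=> uw mt m0; rewrite acoef_step // tau_tau //; first exact: acoef_neq0.
exact: acoef_neq1 uw mt m0.
Qed.

(* Irreducibility forces a way back from a nonzero tau_i m to m, and up to scalars
   the only one is tau_i itself; hence tau_i (tau_i m) cannot vanish. *)
Lemma tau_notP u i m : weyl rs u -> avoids_Z t u -> wt (tact u t) m ->
  tau i (acoef u i) m != 0 ->
  acoef u i <> q ^+ 2 /\ acoef u i <> q ^- 2.
Proof.
move=> uw uZ mt y0; have m0 : m != 0 by apply: contraNneq y0 => ->; rewrite tau0.
have a1 := acoef_neq1 i uw mt m0.
have sw : weyl rs (Sa i \o u)%VF by apply: weyl_comp => //; exact: weyl_simple.
have yt := wt_tau_u uw mt a1.
have [r rP mE] := weight_span sw uw (avoids_Z_step tT uw a1 uZ) uZ yt y0 mt.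
suff /negP : ~~ ((acoef u i == q ^+ 2) || (acoef u i == q ^- 2)).
  by move=> h; split=> E; apply: h; rewrite E eqxx ?orbT.
rewrite -tau_coef_eq0 ?acoef_neq0 //; apply: contraNneq (m0) => c0.
rewrite mE big_seq big1 // => p /rP[pr pE _].
have p2 : p.2 = [:: i].
  apply: reduced_simple => //; apply: (comp_weyl_inj sw).
  by rewrite pE; apply/lfunP => v; rewrite !comp_lfunE simple_K.
by rewrite p2 /= comp_lfun1l (tau_twice i uw mt m0) c0 sc0 scr0.
Qed.

Lemma tau_word_Pset u s m : weyl rs u -> avoids_Z t u -> wt (tact u t) m ->
  tau_word u s m != 0 ->
  inversions (word s \o u)%VF `&` Pset q t = inversions u `&` Pset q t.
Proof.
move=> uw uZ mt; elim: s => [|i s IH]; first by rewrite comp_lfun1l.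
move=> y0; have y0' := tau_word_head y0.
have ww : weyl rs (word s \o u)%VF by apply: weyl_comp => //; exact: weyl_word.
have [a1 a2] := tau_notP ww (avoids_Z_tau_word uw mt uZ y0')
  (wt_tau_word s uw mt) y0.
by rewrite -[word _]/(Sa i \o word s)%VF -comp_lfunA Pset_step // IH.
Qed.

(** The expansion of a nonzero x by [weight_span] is not empty, and each of its words is a path from
    u to w along nonzero vectors. *)
Lemma weight_Pset u w m x : weyl rs u -> weyl rs w -> avoids_Z t u ->
  avoids_Z t w -> wt (tact u t) m -> m != 0 -> wt (tact w t) x -> x != 0 ->
  inversions w `&` Pset q t = inversions u `&` Pset q t.
Proof.
move=> uw ww uZ wZ mt m0 xt x0.
have [[|p r] rP xE] := weight_span uw ww uZ wZ mt m0 xt.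
  by rewrite xE big_nil eqxx in x0.
have [_ <- y0] := rP p (mem_head _ _).
exact: tau_word_Pset.
Qed.

(** A reduced word of u w^-1 is a path from u to w. Its first letter crosses b = u^-1 alpha_i;
    whichever of b and -b is positive is inverted by exactly one of u and w. It therefore lies in
    neither Z(t) nor P(t), so tau_i m is nonzero and the same hypotheses hold at s_i u. *)
Lemma weight_connected u w m : weyl rs u -> weyl rs w -> avoids_Z t u ->
  avoids_Z t w -> inversions w `&` Pset q t = inversions u `&` Pset q t ->
  wt (tact u t) m -> m != 0 -> exists2 x, x != 0 & wt (tact w t) x.
Proof.
move=> uw ww + wZ; have [s sr sE] := reduced_ex (weyl_comp uw (weylV ww)).
elim: s u uw m sr sE => [|i s IH] u uw m sr sE uZ wP mt m0.
  exists m => //; suff -> : w = u by [].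
  apply/lfunP => v; have := congr1 (fun f : 'End(V) => f (w v)) sE.
  by rewrite comp_lfunE (weylK ww) id_lfunE.
have uE v : u v = word (i :: s) (w v) by rewrite sE comp_lfunE (weylK ww).
have sgnw : 0 < ip rho (w ((u^-1)%VF (al i))) <-> False.
  split=> //; have := reduced_cons_pos sr.
  have -> : w ((u^-1)%VF (al i)) = - ((word s)^-1)%VF (al i).
    apply: (weyl_inj (weyl_word rs (i :: s))).
    rewrite -uE (weylVK uw) [RHS]linearN /= comp_lfunE (weylVK (weyl_word rs s)).
    by rewrite simple_self opprK.
  by rewrite ipNr oppr_gt0 => h /(lt_trans h); rewrite ltxx.
have br : (u^-1)%VF (al i) \in Phi.
  by rewrite weyl_root ?simple_roots //; exact: weylV.
pose b : weight rs := Weight (root_weight br).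
have ub : u (wval b) = al i by rewrite /= (weylVK uw).
have wbNE (v : 'End(V)) : v (wval (- b)) = - v (wval b).
  by rewrite -[wval (- b)]/(- wval b) linearN.
have wbr : w (wval b) \in Phi by rewrite weyl_root.
have wb : positive_root rs (- w (wval b)).
  by have [/positive_rho/sgnw|] := root_sign wbr.
have tb : acoef u i = t b.
  by rewrite /tact; congr t; apply: wact_eq; [exact: weylV|].
have al_pos := positive_simple rs i.
have npos a : positive_root rs a -> positive_root rs (- a) -> False.
  move=> /positive_rho h /positive_rho; rewrite ipNr oppr_gt0.
  by move=> /(lt_trans h); rewrite ltxx.
have tN c : t b = c -> t (- b) = c^-1 by move=> <-; rewrite torusN.
have a1 : acoef u i != 1.
  rewrite tb; apply/eqP => tb1; have [bp|bp] := root_sign br.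
    exact: npos (wZ b bp tb1) wb.
  have := uZ (- b) bp; rewrite (tN _ tb1) invr1 => /(_ erefl) h; apply: npos h _.
  by rewrite wbNE opprK ub.
have notP : ~ (t b = q ^+ 2 \/ t b = q ^- 2).
  move=> tbq; have [bp|bp] := root_sign br.
    have : (inversions w `&` Pset q t) b by split.
    by rewrite wP => -[[_]]; rewrite /negative_root ub => /(npos _ al_pos).
  have : (inversions u `&` Pset q t) (- b).
    split; split; [exact: bp| |exact: bp|].
      by rewrite /negative_root wbNE opprK ub.
    by case: tbq => /tN ->; rewrite ?invrK; [right|left].
  rewrite -wP => -[[_]]; rewrite /negative_root wbNE opprK.
  by move=> h; case: (npos _ h wb).
have sw : weyl rs (Sa i \o u)%VF by apply: weyl_comp => //; exact: weyl_simple.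
have y0 : tau i (acoef u i) m != 0.
  apply/eqP => y0; have := tau_twice i uw mt m0; rewrite y0 tau0 => /esym/sc_eq0.
  move=> [/eqP|/eqP]; last by rewrite (negPf m0).
  rewrite tau_coef_eq0 ?acoef_neq0 // tb => /orP[] /eqP E; apply: notP.
    by left.
  by right.
apply: (IH (Sa i \o u)%VF sw _ (reduced_tail sr) _ _ _ (wt_tau_u uw mt a1) y0).
- apply/lfunP => v; have := congr1 (fun f : 'End(V) => Sa i (f v)) sE.
  by rewrite word_cons simple_K !comp_lfunE.
- exact: avoids_Z_step.
- rewrite wP Pset_step // tb => E; apply: notP; by [left|right].
Qed.

End CalibratedModule.

(** * Restriction to the subalgebras that define calibratability *)

Section Restriction.
Variables (R : realType) (V : vectType R) (n : nat) (rs : rootSystem V n).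
Variable q : R[i].
Variables (i j : 'I_n) (M : lmodType (hecke rs q)).
Local Notation H2 := (@hecke2 R V n rs q i j).

(** An alias of M that can carry the module structure over the subalgebra. *)
Definition res2 : Type := M.
HB.instance Definition _ := GRing.Zmodule.on res2.

Definition res2_scale (h : H2) (m : res2) : res2 := subalg_val h *: (m : M).

Fact res2_scaleA a b x : res2_scale a (res2_scale b x) = res2_scale (a * b) x.
Proof. by rewrite /res2_scale scalerA. Qed.

Fact res2_scale1 : left_id 1 res2_scale.
Proof. by move=> x; rewrite /res2_scale scale1r. Qed.

Fact res2_scaleDr : right_distributive res2_scale +%R.
Proof. by move=> a x y; rewrite /res2_scale scalerDr. Qed.

Fact res2_scaleDl x : {morph res2_scale^~ x : a b / a + b}.
Proof. by move=> a b; rewrite /res2_scale -scalerDl. Qed.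

HB.instance Definition _ := GRing.Zmodule_isLmodule.Build H2 res2
  res2_scaleA res2_scale1 res2_scaleDr res2_scaleDl.

(** Restriction changes neither the complex scalars nor the action of X, so the basis and the weight
    spaces of M serve again. *)
Lemma res2_calibrated t (x : M) :
  calibrated (@hX R V n rs q) M -> weight_space (@hX R V n rs q) t x -> x != 0 ->
  exists N : lmodType H2, calibrated (@hecke2_X R V n rs q i j) N /\
    exists2 m : N, m != 0 & weight_space (@hecke2_X R V n rs q i j) t m.
Proof.
move=> [[d [b [_ bP]]] Mcal] xt x0; exists res2; split; last by exists x.
split; first by exists d, b.
move=> t' t'T; have := Mcal t' t'T; rewrite !predeqE => E m; apply: iff_trans (E m).
have pw (a : H2) k : subalg_val (a ^+ k) = subalg_val a ^+ k.
  by elim: k => // k IH; rewrite !exprS -IH.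
have E2 l k : (@hX R V n rs q l - (t' l)%:A) ^+ k *: (m : M) =
    subalg_val ((@hecke2_X R V n rs q i j l - (t' l)%:A) ^+ k) *: (m : M).
  by rewrite pw.
split=> h l; have [k k0 kE] := h l; exists k => //; first by rewrite E2.
by rewrite E2 in kE.
Qed.

End Restriction.

(** * Existence of a weight and its place in the orbit *)

Section Eigenvector.
Variables (R : realType) (V : vectType R) (n : nat) (rs : rootSystem V n).
Variable q : R[i].
Variable M : lmodType (hecke rs q).
Local Notation X := (@hX R V n rs q).
Local Notation wt := (weight_space X (M := M)).

Lemma common_eigen (hs : seq (hecke rs q)) : finite_dim M -> (exists m : M, m != 0) ->
  {in hs &, forall a b, a * b = b * a} ->
  exists2 m : M, m != 0 & forall h, h \in hs -> exists c, h *: m = sc c m.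
Proof.
move=> [d [b [_ bP]]] [m0 m0n] comm.
pose vec (v : 'rV[R[i]]_d) : M := \sum_i sc (v 0 i) (b i).
have vecK m : exists v, m = vec v.
  have [c [cE _]] := bP m Logic.I; exists (\row_i c i).
  by rewrite /vec [LHS]cE; apply: eq_bigr => i _; rewrite mxE.
have vec_inj : injective vec.
  move=> u v E; have [c [_ cU]] := bP (vec u) Logic.I.
  have cE w : vec w = vec u -> c = [ffun i => w 0 i].
    by move=> wu; apply: cU; rewrite -wu /vec; apply: eq_bigr => i _; rewrite ffunE.
  apply/rowP => i; have := cE u erefl; rewrite (cE v (esym E)) => /ffunP/(_ i).
  by rewrite !ffunE.
have vec0 : vec 0 = 0 by rewrite /vec big1 // => i _; rewrite mxE sc0.
have vecZ c v : vec (c *: v) = sc c (vec v).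
  by rewrite /vec sc_sumr; apply: eq_bigr => i _; rewrite mxE scA.
have actE (h : hecke rs q) : exists A : 'M[R[i]]_d, forall v, h *: vec v = vec (v *m A).
  pose a i := sval (cid (vecK (h *: b i))).
  have aE i : h *: b i = vec (a i) by exact: svalP (cid (vecK (h *: b i))).
  exists (\matrix_(i, j) a i 0 j) => v; rewrite /vec scaler_sumr.
  under eq_bigr do rewrite sc_comm aE /vec sc_sumr.
  rewrite exchange_big; apply: eq_bigr => j _; rewrite mxE sc_suml.
  by apply: eq_bigr => i _; rewrite scA mxE.
pose A h := sval (cid (actE h)).
have AE h v : h *: vec v = vec (v *m A h) by exact: svalP (cid (actE h)) v.
have d0 : (0 < d)%N.
  rewrite lt0n; apply: contraNneq m0n => dE; have [v ->] := vecK m0.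
  rewrite /vec big1 // => i _.
  by have d1 : (0 < d)%N := leq_ltn_trans (leq0n i) (ltn_ord i); rewrite dE in d1.
have [|v v0 /allP vs] := @common_eigenvector _ d (map A hs) d0.
  move=> _ _ /mapP[h hh ->] /mapP[k kh ->].
  apply/row_matrixP => i; rewrite !row_mul; apply: vec_inj.
  by rewrite -!AE !rowE -!AE !scalerA comm.
exists (vec v); first by rewrite -vec0 (inj_eq vec_inj).
move=> h hh; have /sub_rVP[c cE] := vs _ (map_f A hh).
by exists c; rewrite AE cE vecZ.
Qed.

(** The finitely many X^omega_i commute and generate the group X, so a common eigenvector of them is
    a weight vector. *)
Lemma weight_exists : finite_dim M -> (exists m : M, m != 0) ->
  exists t m, [/\ torus t, wt t m & m != 0].
Proof.
move=> Mfin Mn0.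
have [|m m0 mE] :=
    @common_eigen [seq X (fundamental_weight rs i) | i <- enum 'I_n] Mfin Mn0.
  by move=> _ _ /mapP[i _ ->] /mapP[j _ ->]; rewrite -!hXD addrC.
have ex l : exists c, X l *: m = sc c m.
  elim/weight_ind: l => [|l k [c cE] [d dE]|l [c cE]|i].
  - by exists 1; rewrite hX0 scale1r sc1.
  - by exists (c * d); rewrite hXD -scalerA dE sc_comm cE scA mulrC.
  - have E : m = sc c (X (- l) *: m).
      by rewrite -sc_comm -cE scalerA -hXD addNr hX0 scale1r.
    have c0 : c != 0 by apply: contraNneq m0 => c0; rewrite E c0 sc0.
    by exists c^-1; rewrite {2}E scA mulVf // sc1.
  - by apply: mE; apply: map_f; rewrite mem_enum.
pose t l := sval (cid (ex l)).
have tE l : X l *: m = sc (t l) m by exact: svalP (cid (ex l)).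
have sc_inj c d : sc c m = sc d m -> c = d.
  move=> /eqP; rewrite -subr_eq0 -scN -scDl => /eqP/sc_eq0[/eqP|/eqP].
    by rewrite subr_eq0 => /eqP.
  by rewrite (negPf m0).
have tD l k : t (l + k) = t l * t k.
  by apply: sc_inj; rewrite -tE hXD -scalerA tE sc_comm tE scA mulrC.
exists t, m; split=> //; split=> // l.
apply: contraNneq m0 => tl.
have t0 : t 0 = 1 by apply: sc_inj; rewrite -tE hX0 scale1r sc1.
by rewrite -[m]sc1 -t0 -[0](subrr l) tD tl mul0r sc0.
Qed.

(* Orbit sums are central, and distinct characters are linearly independent. *)
Lemma weight_in_orbit t t' (m : M) : central_character M t -> torus t' ->
  wt t' m -> m != 0 -> exists2 w, weyl rs w & t' = tact w t.
Proof.
move=> [tT tC] t'T mt' m0; have [W [uW WE]] := weyl_finite rs.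
pose p l : group_algebra rs := \sum_(w <- W) << wact w l >>.
have pE l k : (p l)@_k = (count (fun w => wact w l == k) W)%:R.
  rewrite /p raddf_sum /= -sum1_count natr_sum [RHS]big_mkcond /=.
  by apply: eq_bigr => w _; rewrite mcoeffU; case: eqP.
have pinv l : Defs.invariant (p l).
  move=> u k uw; rewrite !pE; congr (_ %:R).
  have ucomp : perm_eq [seq (u \o w)%VF | w <- W] W.
    apply: uniq_perm => //.
      rewrite map_inj_in_uniq // => v w _ _ E; apply/lfunP => x.
      apply: (weyl_inj uw); rewrite -!comp_lfunE.
      by rewrite E.
    move=> w; apply/mapP/idP => [[v /WE vw ->]|/WE ww].
      by apply/WE; exact: weyl_comp.
    exists (u^-1 \o w)%VF; first by apply/WE/weyl_comp => //; exact: weylV.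
    by apply/lfunP => x; rewrite !comp_lfunE (weylVK uw).
  rewrite -(seq.permP ucomp) count_map; apply: eq_in_count => w /WE ww /=.
  rewrite wact_comp //; apply/eqP/eqP => [E|->//].
  apply: val_inj; apply: (weyl_inj uw).
  by have := congr1 val E; rewrite /= !val_wact.
have mmapp l (s : weight rs -> R[i]) : mmap id s (p l) = \sum_(w <- W) s (wact w l).
  rewrite /p (raddf_sum (mmap (idfun : {additive R[i] -> R[i]}) s)) /=.
  by apply: eq_bigr => w _; rewrite (mmapU (f := idfun)) mul1r.
have key l : \sum_(w <- W) t' (wact w l) = \sum_(w <- W) t (wact w l).
  have := tC (p l) (pinv l) m; rewrite (mmap_wt _ mt') -/(sc _ _) !mmapp => /eqP.
  rewrite -subr_eq0 -scN -scDl => /eqP/sc_eq0[/eqP|/eqP].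
    by rewrite subr_eq0 => /eqP.
  by rewrite (negPf m0).
(* [cev_separate] asks for a torus element at every index, so outside W the family falls back on s
   itself. *)
have torus_orbit (s : weight rs -> R[i]) w : torus s ->
    torus (if w \in W then s \o wact w else s).
  move=> sT; case: ifP => // /WE ww; split=> [l|l k] /=; first exact: (torus_neq0 sT).
  by rewrite wactD // torusD.
pose ts (bw : bool * 'End(V)) := 
  let s := if bw.1 then t' else t in if bw.2 \in W then s \o wact bw.2 else s.
have tsT bw : torus (ts bw) by apply: torus_orbit; case: bw.1.
pose r := [seq (true, w) | w <- W] ++ [seq (false, w) | w <- W].
have [f [ft fr]] := cev_separate r t'T tsT.
have keyf : \sum_(w <- W) cev f (ts (true, w)) = \sum_(w <- W) cev f (ts (false, w)).
  rewrite /cev exchange_big [RHS]exchange_big /=; apply: eq_bigr => x _.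
  rewrite -!mulr_sumr; congr (_ * _).
  rewrite big_seq [RHS]big_seq /ts /=.
  rewrite (eq_bigr (fun w => t' (wact w x.2))); last by move=> w ->.
  rewrite [RHS](eq_bigr (fun w => t (wact w x.2))); last by move=> w ->.
  by rewrite -!big_seq.
have one : \1%VF \in W by apply/WE; exact: weyl1.
have tsr b w : w \in W -> (b, w) \in r.
  move=> wW; rewrite mem_cat.
  by case: b; apply/orP; [left|right]; apply/mapP; exists w.
(* This sum counts the w that fix t', among them the identity. The equal sum over the orbit of t is
   then nonzero, so t' occurs there. *)
have : \sum_(w <- W) cev f (ts (true, w)) != 0.
  rewrite (bigD1_seq \1%VF) //= fr ?tsr //.
  have -> : `[< ts (true, \1%VF) = t' >].
    by apply/asboolP; rewrite /ts /= one; apply/funext => l /=; rewrite wact1.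
  apply: lt0r_neq0; apply: ltr_wpDr; last exact: ltr01.
  rewrite big_seq_cond; apply: sumr_ge0 => w /andP[wW _].
  by rewrite fr ?tsr //; case: asbool; rewrite ?ler01.
rewrite keyf; case: (pselect (exists2 w, w \in W & ts (false, w) = t')).
  move=> [w wW E] _; move: (wW) => /WE ww; exists (w^-1)%VF; first exact: weylV.
  rewrite -E /ts /= wW; apply/funext => l; rewrite /tact /=; congr (t (wact _ _)).
  apply/lfunP => x; apply: (weyl_inj (weylV ww)).
  by rewrite (weylK ww) (weylVK (weylV ww)).
move=> nE /eqP[]; rewrite big_seq big1 // => w wW.
by rewrite fr ?tsr //; case: asboolP => // E; case: nE; exists w.
Qed.

(* Among all u with ut a given point of the orbit, the one moving rho the least
   has no inversion in Z(t). *)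
Lemma minimal_representative (t : weight rs -> R[i]) w : torus t -> weyl rs w ->
  exists u, [/\ weyl rs u, avoids_Z t u & tact u t = tact w t].
Proof.
move=> tT ww; have [W [_ WE]] := weyl_finite rs.
pose W' := [seq u <- W | `[< tact u t = tact w t >]].
have [|u + umax] := @seq_argmax _ _ (fun u : 'End(V) => ip rs (u (rho rs)) (rho rs)) W' w.
  by rewrite mem_filter; apply/andP; split; [apply/asboolP|apply/WE].
rewrite mem_filter => /andP[/asboolP ut /WE uw]; exists u; split=> // a ap ta.
have ar := ap.1; have uar : u (wval a) \in Defs.roots rs by rewrite weyl_root.
have [//|neg] := root_sign uar.
(* The reflection s_a fixes t, so u s_a competes with u; it sends rho to u rho minus a positive
   multiple of u a, which pairs better with rho if u a is negative. *)
have sw := weyl_s ar; have := umax (u \o s_ rs (wval a))%VF.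
rewrite mem_filter; case: asboolP => [_|[]]; last first.
  by rewrite tact_comp // tact_refl_fixed.
have -> /= : (u \o s_ rs (wval a))%VF \in W by apply/WE; exact: weyl_comp.
move=> /(_ isT); rewrite comp_lfunE s_E /refl /reflection linearB linearZ /=.
rewrite ipBl ipZl gerBl ip_coroot leNgt => /negP[].
rewrite pmulr_rlt0.
  by have := positive_rho neg; rewrite ipNr oppr_gt0 ip_sym.
by rewrite !mulr_gt0 ?invr_gt0 ?ip_root_gt0 //; exact: positive_rho.
Qed.

End Eigenvector.

(** * Subspaces of dimension zero and one *)

Section Dimension.
Variables (R : realType) (V : vectType R) (n : nat) (rs : rootSystem V n).
Variable q : R[i].
Variable M : lmodType (hecke rs q).

Lemma has_dim0 (U : set M) : (forall x, U x -> x = 0) -> has_dim U 0.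
Proof.
move=> U0; exists (fun=> 0); split=> [[]//|x /U0 ->].
exists [ffun=> 0]; split; first by rewrite big_ord0.
by move=> c _; apply/ffunP => -[].
Qed.

Lemma has_dim1 (U : set M) x : U x -> x != 0 ->
  (forall y, U y -> exists c, y = sc c x) -> has_dim U 1.
Proof.
move=> Ux x0 Uc; exists (fun=> x); split=> // y /Uc[c ->].
exists [ffun=> c]; split=> [|d]; first by rewrite big_ord1 ffunE.
rewrite big_ord1 -/(sc _ _) => /eqP; rewrite -subr_eq0 -scN -scDl.
move=> /eqP/sc_eq0[/eqP|/eqP]; last by rewrite (negPf x0).
by rewrite subr_eq0 => /eqP ->; apply/ffunP => i; rewrite ffunE (ord1 i).
Qed.

Lemma has_dim1_neq0 (U : set M) : has_dim U 1 -> exists2 x, U x & x != 0.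
Proof.
move=> [b [bU bP]]; exists (b ord0) => //; apply/eqP => b0.
have [c [_ cU]] := bP _ (bU ord0).
have E e : b ord0 = \sum_i (e i : R[i])%:A *: b i.
  by rewrite big_ord1 b0 scaler0.
have := cU [ffun=> 0] (E _); rewrite (cU [ffun=> 1] (E _)) => /ffunP/(_ ord0).
by rewrite !ffunE => /eqP; rewrite oner_eq0.
Qed.

End Dimension.

Theorem theorem3p2 (R : realType) (V : vectType R) (n : nat)
    (rs : rootSystem V n) (q : R[i])
    (q_neq0 : q != 0) (q2_neq1 : q ^+ 2 != 1) (q2_neqN1 : q ^+ 2 != -1)
    (M : lmodType (hecke rs q)) (t : weight rs -> R[i])
    (M_irr : irreducible M) (M_cal : calibrated (@hX R V n rs q) M)
    (M_t : central_character M t) :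
  exists! J : set (weight rs),
    skew_local_region q t J /\
    forall w : 'End(V), weyl rs w -> inversions w `&` Zset t = set0 ->
      has_dim (weight_space (@hX R V n rs q) (M := M) (tact w t))
        (if w \in Fset q t J then 1 else 0)%N.
Proof.
have [M_fin M_gen] := M_cal; have [tT _] := M_t; have [M_neq0 _] := M_irr.
have [t' [m [t'T mt' m0]]] := weight_exists M_fin M_neq0.
have [w0 w0W t'E] := weight_in_orbit M_t t'T mt' m0.
have [u [uw uZ ut]] := minimal_representative tT w0W.
have mt : weight_space (@hX R V n rs q) (tact u t) m by rewrite ut -t'E.
pose J := inversions u `&` Pset q t.
have uF : Fset q t J u by split=> //; apply/avoids_ZP.
have dim w : weyl rs w -> inversions w `&` Zset t = set0 ->
    has_dim (weight_space (@hX R V n rs q) (M := M) (tact w t))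
      (if w \in Fset q t J then 1 else 0)%N.
  move=> ww /(avoids_ZP _ ww) wZ; case: ifPn => [|/negP] wF.
    move: wF; rewrite inE => -[_ _ wP].
    have [x x0 xt] := weight_connected q_neq0 q2_neq1 M_gen tT uw ww uZ wZ wP mt m0.
    apply: (has_dim1 xt x0) => y.
    exact: (weight_line q_neq0 q2_neq1 M_gen M_irr tT ww wZ xt x0).
  apply: has_dim0 => x xt; apply/eqP; apply: contra_notT wF => x0.
  rewrite inE; split=> //; first exact/avoids_ZP.
  exact: (weight_Pset q_neq0 q2_neq1 M_gen M_irr tT uw ww uZ wZ mt m0 xt x0).
exists J; split; first split=> //.
  split; first by split=> //; [move=> a [] | exists u].
  move=> w wF; have [ww wZ _] := wF; have := dim w ww wZ; rewrite mem_set //.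
  move=> /has_dim1_neq0[x xt x0] i j.
  exact: (res2_calibrated i j M_cal xt x0).
(* The region of J' is nonempty, so some w in it has a nonzero weight space, and [weight_Pset]
   recovers J' from w. *)
move=> J' [[[_ _ [w wF']] _] dim'].
have [ww wZ wP'] := wF'.
have [x xt x0] : exists2 x, weight_space (@hX R V n rs q) (M := M) (tact w t) x & x != 0.
  by apply: has_dim1_neq0; have := dim' w ww wZ; rewrite mem_set.
rewrite -wP'; apply/esym.
apply: (weight_Pset q_neq0 q2_neq1 M_gen M_irr tT uw ww uZ _ mt m0 xt x0).
exact/avoids_ZP.
Qed.
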